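(* Let $n,p,k\ge1$ be integers and let $X=(x_{ij})$ be a real $n\times p$ random matrix which has the same distribution as $UXV$ for any real orthogonal matrices $U$ (of size $n\times n$) and $V$ (of size $p\times p$). For any two sequences $\mathbf{i}=(i_1,\dots,i_{2k})$ in $\{1,\dots,n\}$ and $\mathbf{j}=(j_1,\dots,j_{2k})$ in $\{1,\dots,p\}$, $$E[x_{i_1j_1}\cdots x_{i_{2k}j_{2k}}]=\sum_{\sigma_1,\sigma_2,\pi\in M_{2k}}\delta'_{\sigma_1}(\mathbf{i})\,\delta'_{\sigma_2}(\mathbf{j})\,\mathrm{Wg}^{\mathrm O}(\pi\sigma_1^{-1}\sigma_2;n,p)\,E[\mathrm{Tr}'_\pi(XX^{\mathrm t})].$$
   Context: $A^{\mathrm t}$ denotes the transpose of $A$. $S_{2k}$ is the symmetric group on $\{1,\dots,2k\}$, with product $(\sigma\tau)(i)=\sigma(\tau(i))$. For $\sigma\in S_{2k}$, let $\Gamma(\sigma)$ be the undirected (multi)graph with vertices $1,\dots,2k$ and edges $\{2i-1,2i\}$ and $\{\sigma(2i-1),\sigma(2i)\}$ for $i=1,\dots,k$ (edges of the two kinds are distinguished even if they coincide). Its connected components have even sizes $2\mu_1\ge2\mu_2\ge\dots\ge2\mu_l$; the partition $\mu=(\mu_1,\dots,\mu_l)$ of $k$ is the coset-type of $\sigma$, and $\kappa'(\sigma)=l$ is the number of components. $M_{2k}$ is the set of pair partitions of $\{1,\dots,2k\}$. Each is written uniquely as $\{\{\sigma(1),\sigma(2)\},\dots,\{\sigma(2k-1),\sigma(2k)\}\}$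 with $1=\sigma(1)<\sigma(3)<\dots<\sigma(2k-1)$ and $\sigma(2i-1)<\sigma(2i)$, and is thereby identified with the permutation $\sigma\in S_{2k}$; so $M_{2k}\subset S_{2k}$. For $\sigma\in S_{2k}$ and $\mathbf{i}=(i_1,\dots,i_{2k})$, $\delta'_\sigma(\mathbf{i})=\prod_{s=1}^k\delta_{i_{\sigma(2s-1)},i_{\sigma(2s)}}$ (Kronecker deltas). For a square matrix $A$ and $\sigma\in S_{2k}$ of coset-type $(\mu_1,\dots,\mu_l)$, $\mathrm{Tr}'_\sigma(A)=\prod_{j=1}^l\mathrm{Tr}(A^{\mu_j})$. $H_k\subset S_{2k}$ is the hyperoctahedral group of order $2^kk!$, the centralizer of $(1\ 2)(3\ 4)\cdots(2k-1\ 2k)$. $L(S_{2k},H_k)$ is the space of $H_k$-biinvariant functions $S_{2k}\to\mathbb{C}$, a commutative algebra under $(f_1\sharp f_2)(\sigma)=\sum_{\tau\in M_{2k}}f_1(\sigma\tau)f_2(\tau^{-1})$, with identity the indicator function $\mathbf{1}_{H_k}$. For $z\in\mathbb{C}$, the orthogonal Weingarten function $\mathrm{Wg}^{\mathrm O}(\cdot;z)$ is the unique element of $L(S_{2k},H_k)$ with $z^{\kappa'(\cdot)}\sharp\mathrm{Wg}^{\mathrm O}(\cdot;z)\sharp z^{\kappa'(\cdot)}=z^{\kappa'(\cdot)}$ and $\mathrm{Wg}^{\mathrm O}(\cdot;z)\sharp z^{\kappa'(\cdot)}\sharp\mathrm{Wg}^{\mathrm O}(\cdot;z)=\mathrm{Wg}^{\mathrm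 O}(\cdot;z)$. The double-parameter version is, for $z,w\in\mathbb{C}$, $\mathrm{Wg}^{\mathrm O}(\cdot;z,w)=\mathrm{Wg}^{\mathrm O}(\cdot;z)\sharp\mathrm{Wg}^{\mathrm O}(\cdot;w)$. Explicitly, $$\mathrm{Wg}^{\mathrm O}(\cdot;z)=\frac{2^kk!}{(2k)!}\sum_{\lambda\vdash k,\ C'_\lambda(z)\ne0}\frac{f^{2\lambda}}{C'_\lambda(z)}\omega^\lambda,\qquad \mathrm{Wg}^{\mathrm O}(\cdot;z,w)=\frac{2^kk!}{(2k)!}\sum_{\lambda\vdash k,\ C'_\lambda(z)C'_\lambda(w)\ne0}\frac{f^{2\lambda}}{C'_\lambda(z)C'_\lambda(w)}\omega^\lambda,$$ where $C'_\lambda(z)=\prod_{i=1}^{\ell(\lambda)}\prod_{j=1}^{\lambda_i}(z+2j-i-1)$, $\ell(\lambda)$ is the length of the partition $\lambda$, $\omega^\lambda=(2^kk!)^{-1}\chi^{2\lambda}*\mathbf{1}_{H_k}$ (with $(f_1*f_2)(\pi)=\sum_{\tau\in S_{2k}}f_1(\tau)f_2(\tau^{-1}\pi)$), $2\lambda=(2\lambda_1,2\lambda_2,\dots)$, $\chi^{2\lambda}$ is the irreducible character of $S_{2k}$ indexed by $2\lambda$, and $f^{2\lambda}=\chi^{2\lambda}(e)$ with $e$ the identity permutation.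
   Formalization: The argument of Wg^O is π^{-1}σ_1^{-1}σ_2 instead of πσ_1^{-1}σ_2, since the printed identity fails for n=p=k=2 and X Haar on O(2); the entries of X are assumed to have finite 2k-th moments so that the expectations exist. *)

(* Defs.v *)
From HB Require Import structures.
From mathcomp Require Import all_boot all_order all_algebra all_fingroup.
From mathcomp Require Import all_classical all_reals all_analysis.
From mathcomp.real_closed Require Import complex.

Set Implicit Arguments.
Unset Strict Implicit.
Unset Printing Implicit Defensive.

Import Order.TTheory GRing.Theory Num.Theory.
Import numFieldNormedType.Exports.

Local Open Scope classical_set_scope.
Local Open Scope ring_scope.

(* The points 1, ..., 2k are encoded as 0, ..., 2k-1, so that the pair
   {2i-1, 2i}, 1 <= i <= k, becomes {oddpt i, evenpt i} = {2i, 2i+1},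
   0 <= i < k. *)
Lemma oddpt_proof k (i : 'I_k) : (i.*2 < k.*2)%N.
Proof. by rewrite ltn_double. Qed.

Lemma evenpt_proof k (i : 'I_k) : (i.*2.+1 < k.*2)%N.
Proof. by rewrite ltn_Sdouble. Qed.

Definition oddpt k (i : 'I_k) : 'I_(k.*2) := Ordinal (oddpt_proof i).
Definition evenpt k (i : 'I_k) : 'I_(k.*2) := Ordinal (evenpt_proof i).

(* (s \op t) i = s (t i): the product of permutations is composition from
   right to left, whereas the group law of {perm _} composes from left to
   right. *)
Definition perm_op n (s t : 'S_n) : 'S_n := (t * s)%g.
Notation "s \op t" := (perm_op s t) (at level 40, left associativity).

Lemma perm_opE n (s t : 'S_n) i : (s \op t) i = s (t i).
Proof. exact: permM. Qed.

Section CosetType.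
Variable k : nat.
Implicit Types s : 'S_(k.*2).

(* Multiplicities of edges are irrelevant for connectedness, so a relation
   suffices. *)
Definition Gamma s : rel 'I_(k.*2) := fun x y =>
  [exists i : 'I_k,
    [|| [set x; y] == [set oddpt i; evenpt i]
      | [set x; y] == [set s (oddpt i); s (evenpt i)]]]%SET.

Definition Gamma_components s : {set {set 'I_(k.*2)}} :=
  equivalence_partition (connect (Gamma s)) [set: 'I_(k.*2)]%SET.

Definition coset_type s : seq nat :=
  sort geq [seq #|B|./2 | B : {set 'I_(k.*2)} <- enum (Gamma_components s)].

Definition kappa' s : nat := #|Gamma_components s|.

Definition pair_partitions : {set 'S_(k.*2)} :=
  [set s : 'S_(k.*2) |
    [&& [forall i : 'I_k, (val i == 0)%N ==> (val (s (oddpt i)) == 0)%N],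
        [forall i : 'I_k, forall j : 'I_k,
           (i < j)%N ==> (s (oddpt i) < s (oddpt j))%N]
      & [forall i : 'I_k, (s (oddpt i) < s (evenpt i))%N]]]%SET.

Definition hyperoctahedral : {group 'S_(k.*2)} :=
  'C[\prod_(i < k) tperm (oddpt i) (evenpt i)]%G.

End CosetType.

Definition delta' (C : pzSemiRingType) k n (s : 'S_(k.*2))
    (i : 'I_(k.*2) -> 'I_n) : C :=
  \prod_(r < k) (i (s (oddpt r)) == i (s (evenpt r)))%:R.

Definition Tr' (C : comPzRingType) k n (s : 'S_(k.*2)) (A : 'M[C]_n) : C :=
  \prod_(m <- coset_type s) \tr (A ^+ m).

Section Weingarten.
Variables (R : realType) (k : nat).
Local Notation S2k := 'S_(k.*2).
Implicit Types (f g : {ffun S2k -> R[i]}) (z w : R[i]).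

Definition biinvariant f : Prop :=
  forall (s h1 h2 : S2k), h1 \in hyperoctahedral k -> h2 \in hyperoctahedral k ->
    f (h1 \op s \op h2) = f s.

Definition sharp f g : {ffun S2k -> R[i]} :=
  [ffun s => \sum_(t in pair_partitions k) f (s \op t) * g (t^-1)%g].

Definition pow_kappa' z : {ffun S2k -> R[i]} := [ffun s => z ^+ kappa' s].

Definition is_WgO z (W : {ffun S2k -> R[i]}) : Prop :=
  [/\ biinvariant W,
      sharp (sharp (pow_kappa' z) W) (pow_kappa' z) = pow_kappa' z
    & sharp (sharp W (pow_kappa' z)) W = W].

(* The default value 0 is irrelevant: there is exactly one W with is_WgO z W. *)
Definition WgO z : {ffun S2k -> R[i]} := xget [ffun=> 0] [set W | is_WgO z W].

Definition WgO2 z w : {ffun S2k -> R[i]} := sharp (WgO z) (WgO w).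

End Weingarten.

Section RandomMatrix.
Variables (d : measure_display) (T : measurableType d) (R : realType).
Variables (P : probability T R) (n p : nat).

(* 'M[R]_(n, p) carries its Borel sigma-algebra. *)
Local Notation borel_mx := (g_sigma_algebraType (@open 'M[R]_(n, p))).

Definition random_matrix (X : T -> 'M[R]_(n, p)) : Prop :=
  measurable_fun [set: T] (X : T -> borel_mx).

Definition same_distribution (X Y : T -> 'M[R]_(n, p)) : Prop :=
  forall B : set borel_mx, measurable B ->
    pushforward P (X : T -> borel_mx) B = pushforward P (Y : T -> borel_mx) B.

End RandomMatrix.

Definition orthogonal_mx (R : comPzRingType) n (U : 'M[R]_n) : Prop :=
  U *m U^T = 1%:M /\ U^T *m U = 1%:M.

(* The expectation of a real random variable, as a complex number; it is
   meaningful for integrable random variables. *)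
Definition expectC d (T : measurableType d) (R : realType)
    (P : probability T R) (Y : T -> R) : R[i] :=
  real_complex R (fine 'E_P[Y]).

(* Main.v *)
(* By orthogonal invariance the array of moments E[x_{i1 j1} ... x_{i2k j2k}] is,
   as a function of i and as a function of j, an invariant tensor, hence
   (first fundamental theorem for O(n)) a combination of the delta'_s. The Gram
   matrix of the delta'_s, s in M_2k, is n^kappa'(s^-1 t), and the Weingarten
   function is a generalized inverse of it; so an invariant tensor T equals
   sum_{s,t} delta'_s Wg(s^-1 t) <delta'_t, T>. Projecting in i and in j leaves
   the contractions of the moments against delta'_{t1} (x) delta'_{t2}, which are
   E[Tr'_{t1^-1 t2}(X X^t)], and the kernels Wg(.;n), E[Tr'(X X^t)], Wg(.;p)
   commute because (S_2k, H_k) is a Gelfand pair.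

   First fundamental theorem: let T be invariant and orthogonal to all the
   delta'_s. By induction on the degree all its contractions vanish. Let A_ab be
   the derivation extending the elementary matrix E_ab; invariance under rotations
   gives A_ab T = A_ba T, and A_ab^* = A_ba, so the sum of all the contractions
   paired with T is
     0 = sum_{a <> b} |A_ab T|^2 + sum_i T_i^2 #{(r, s) : r <> s, i_r = i_s}.
   Hence T_i = 0 as soon as i has a repeated entry, and for the other i a
   reflection changes the sign of T_i. *)

Require Import Defs.
From HB Require Import structures.
From mathcomp Require Import all_boot all_order all_algebra all_fingroup.
From mathcomp Require Import all_classical all_reals all_analysis.
From mathcomp Require Import measurable_realfun ring.
From mathcomp.real_closed Require Import complex.

Set Implicit Arguments.
Unset Strict Implicit.
Unset Printing Implicit Defensive.

Import Order.TTheory GRing.Theory Num.Theory.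
Import numFieldNormedType.Exports.

Local Open Scope ring_scope.

(** * Invariant tensors of the orthogonal group *)

Definition upd (I : finType) (A : Type) (f : {ffun I -> A}) r v : {ffun I -> A} :=
  [ffun x => if x == r then v else f x].

(** The Leibniz rule at 0 in terms of coefficients; it linearizes invariance along a polynomial
    family of matrices. *)
Lemma coef1_prod (R : comNzRingType) (I : finType) (F : I -> {poly R}) :
  (\prod_x F x)`_1 = \sum_x (F x)`_1 * \prod_(y | y != x) (F y)`_0.
Proof.
have H s : uniq s -> (\prod_(x <- s) F x)`_1 =
    \sum_(x <- s) (F x)`_1 * \prod_(y <- s | y != x) (F y)`_0.
  elim: s => [|x s IH] /=; first by rewrite !big_nil coef1.
  case/andP=> xs us; rewrite !big_cons coefM !big_ord_recl big_ord0 addr0 /=.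
  rewrite coef0_prod IH // eqxx /= addrC; congr (_ + _).
    congr (_ * _); rewrite big_seq [RHS]big_seq_cond.
    apply: eq_bigl => y; case: (boolP (y \in s)) => //= ys.
    by apply/esym; apply: contraNneq xs => <-.
  rewrite mulr_sumr big_seq [RHS]big_seq; apply: eq_bigr => y ys.
  rewrite big_cons ifT; first by rewrite mulrCA.
  by apply: contraNneq xs => ->.
exact/H/index_enum_uniq.
Qed.

(** In characteristic zero 0, 1, ..., [size p] - 1 are distinct roots, one more than the degree
    allows. *)
Lemma poly_vanish (R : numDomainType) (p : {poly R}) :
  (forall t, p.[t] = 0) -> p = 0.
Proof.
move=> p0; apply: (@roots_geq_poly_eq0 _ _ [seq m%:R | m <- iota 0 (size p)]).
- by apply/allP=> x _; rewrite /root p0.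
- by rewrite map_inj_uniq ?iota_uniq //; apply: mulrIn; rewrite oner_neq0.
- by rewrite size_map size_iota.
Qed.

(** This is the reflection in the hyperplane orthogonal to [x]: it is symmetric, and its square is 1
    because (x x^T)^2 = q x x^T. *)
Lemma householder_orthogonal (R : fieldType) n (x : 'cV[R]_n) (q : R) :
  x^T *m x = q%:M -> q != 0 ->
  orthogonal_mx (1%:M - (2 / q) *: (x *m x^T)).
Proof.
move=> xq q0; set H := _ - _.
have HT : H^T = H by rewrite /H linearB linearZ /= trmx1 trmx_mul trmxK.
suff HH : H *m H = 1%:M by rewrite /orthogonal_mx HT.
have PP : (x *m x^T) *m (x *m x^T) = q *: (x *m x^T).
  by rewrite mulmxA -(mulmxA x) xq mul_mx_scalar scalemxAl.
rewrite /H mulmxBl !mulmxBr !mul1mx mulmx1 -scalemxAl -scalemxAr PP !scalerA.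
apply/matrixP=> i j; rewrite !mxE; field.
exact: q0.
Qed.

Lemma orthogonal_mulmx (R : comPzRingType) n (U V : 'M[R]_n) :
  orthogonal_mx U -> orthogonal_mx V -> orthogonal_mx (U *m V).
Proof.
case=> U1 U2 [V1 V2]; split; rewrite trmx_mul mulmxA.
  by rewrite -(mulmxA U) V1 mulmx1.
by rewrite -(mulmxA _ U^T) U2 mulmx1.
Qed.

(** The deltas force [g] to agree with [f] off [r], so that only its value [v] at [r] is free. *)
Lemma sum_upd (R : comPzSemiRingType) (I : finType) n (T : {ffun I -> 'I_n} -> R)
    (e : 'I_n -> R) (f : {ffun I -> 'I_n}) r :
  \sum_(g : {ffun I -> 'I_n}) (e (g r) * \prod_(s | s != r) (f s == g s)%:R) * T g
  = \sum_v e v * T (upd f r v).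
Proof.
rewrite (partition_big (fun g : {ffun I -> 'I_n} => g r) xpredT) //=.
apply: eq_bigr => v _.
rewrite (bigD1 (upd f r v)) /=; last by rewrite ffunE eqxx.
rewrite [X in _ + X]big1 ?addr0 => [|g /andP[/eqP gr gf]].
  rewrite big1 ?mulr1; first by rewrite ffunE eqxx.
  by move=> s sr; rewrite ffunE (negPf sr) eqxx.
have /existsP[s /andP[sr fg]] : [exists s, (s != r) && (f s != g s)].
  apply: contraNT gf; rewrite negb_exists => /forallP h; apply/eqP/ffunP => s.
  rewrite ffunE; case: eqVneq => [->//|sr].
  by have := h s; rewrite sr /= negbK => /eqP.
by rewrite (bigD1 s) //= (negPf fg) mul0r mulr0 mul0r.
Qed.

Section FFT.
Variables (R : realFieldType) (n : nat).

(** The positions form an arbitrary finite type, so that two contracted positions can be removed in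
    an induction. *)
Definition tensor_invariant (I : finType) (T : {ffun I -> 'I_n} -> R) :=
  forall U : 'M[R]_n, orthogonal_mx U ->
  forall f : {ffun I -> 'I_n}, \sum_(g : {ffun I -> 'I_n}) (\prod_r U (f r) (g r)) * T g = T f.

(* The operator [A_ab]: the elementary matrix [E_ab] acting as a derivation. *)
Definition replace_index (I : finType) (T : {ffun I -> 'I_n} -> R) a b
    (f : {ffun I -> 'I_n}) :=
  \sum_r (f r == a)%:R * T (upd f r b).

Lemma reflection_orthogonal (a : 'I_n) :
  orthogonal_mx (1%:M - 2 *: (delta_mx a 0 *m (delta_mx a 0 : 'cV[R]_n)^T)).
Proof.
rewrite -[2]divr1; apply: householder_orthogonal; last by rewrite oner_neq0.
apply/matrixP=> i j; rewrite !ord1 !mxE (bigD1 a) //= big1 ?addr0 ?mxE.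
  by rewrite !eqxx mulr1.
by move=> u ua; rewrite !mxE (negPf ua) mul0r.
Qed.

Lemma reflectionE (a i j : 'I_n) :
  (1%:M - 2 *: (delta_mx a 0 *m (delta_mx a 0 : 'cV[R]_n)^T)) i j =
  (i == j)%:R * (1 - 2 * (j == a)%:R).
Proof.
rewrite !mxE big_ord1 !mxE eqxx !andbT.
case: (eqVneq i j) => [->|ij]; first by case: (j == a); rewrite ?mulr1n ?mulr0n; ring.
rewrite !mulr0n; case: (eqVneq i a) ij => [->|_].
  by rewrite eq_sym => /negPf ->; rewrite mulr0n; ring.
by rewrite mulr0n => _; ring.
Qed.

(** Invariance under the rotations in the plane of e_a and e_b, differentiated at the identity. The
    rotations are parametrized rationally, so comparing coefficients of X replaces the
    derivative. *)
Lemma replace_indexC (I : finType) (T : {ffun I -> 'I_n} -> R) a b f :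
  tensor_invariant T -> a != b -> replace_index T a b f = replace_index T b a f.
Proof.
move=> Tinv ab.
(* [N] is (1 + X^2) times the product of the reflection in the direction
   e_a + X e_b and of the reflection in the direction e_a: a rotation which
   is the identity at X = 0. *)
pose x (u : 'I_n) : {poly R} := (u == a)%:R + (u == b)%:R * 'X.
pose N (u v : 'I_n) : {poly R} :=
  ((u == v)%:R * (1 + 'X ^+ 2) - 2 * (x u * x v)) * (1 - 2 * (v == a)%:R).
pose Q := \sum_(g : {ffun I -> 'I_n}) (\prod_r N (f r) (g r)) * (T g)%:P.
(* At each t this is the invariance identity multiplied by (1 + t^2)^#|I|, which clears the
   denominators of the rotation. *)
have Q0 : Q - (1 + 'X ^+ 2) ^+ #|I| * (T f)%:P = 0.
  apply: poly_vanish => t.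
  have q0 : 1 + t ^+ 2 != 0 by rewrite gt_eqF // ltr_pwDl ?sqr_ge0.
  pose xt : 'cV[R]_n := \col_u ((u == a)%:R + (u == b)%:R * t).
  have xtx : xt^T *m xt = (1 + t ^+ 2)%:M.
    apply/matrixP=> i j; rewrite !ord1 !mxE (bigD1 a) //= (bigD1 b) 1?eq_sym //=.
    rewrite big1 ?mxE; first last.
      by move=> u /andP[ua ub]; rewrite !mxE (negPf ua) (negPf ub) !mulr0n; ring.
    by rewrite !eqxx (negPf ab) (eq_sym b) (negPf ab) !mulr0n !mulr1n; ring.
  have := Tinv _ (orthogonal_mulmx (householder_orthogonal xtx q0)
                   (reflection_orthogonal a)) f.
  set U := _ *m _ => TU.
  have UE u v : U u v = (1 + t ^+ 2)^-1 * (N u v).[t].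
    rewrite /U mxE (bigD1 v) //= big1 ?addr0; last first.
      by move=> w wv; rewrite reflectionE (negPf wv) mul0r mulr0.
    rewrite reflectionE eqxx mul1r !mxE big_ord1 !mxE /N /x.
    rewrite -!polyC_natr !hornerE /=; field.
    exact: q0.
  rewrite hornerD hornerN /Q horner_sum -TU !hornerE /=.
  rewrite mulr_sumr -sumrB big1 // => g _; rewrite hornerM hornerC horner_prod.
  under [X in _ - _ * (X * _)]eq_bigr => r _ do rewrite UE.
  rewrite big_split /= prodr_const.
  by rewrite !mulrA -exprMn mulfV // expr1n mul1r subrr.
have N0 u v : (N u v)`_0 = (u == v)%:R.
  rewrite -horner_coef0 /N /x -!polyC_natr !hornerE /=.
  case: (eqVneq u v) => [<-|uv]; last case: (eqVneq u a) uv => [->|_ _].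
  - by case: (u == a); rewrite ?mulr0n ?mulr1n; ring.
  - by rewrite eq_sym => /negPf ->; rewrite ?mulr0n ?mulr1n; ring.
  - by rewrite ?mulr0n ?mulr1n; ring.
(* The infinitesimal rotation, 2 (E_ba - E_ab). *)
have N1 u v : (N u v)`_1 = 2 * ((v == a)%:R * (u == b)%:R
                                - (v == b)%:R * (u == a)%:R).
  have -> : (N u v)`_1 = (N u v)^`().[0] by rewrite horner_coef0 coef_deriv.
  rewrite /N /x -!polyC_natr !poly.derivE !hornerE /=.
  case: (eqVneq v a) => [->|_]; first rewrite (negPf ab).
    by rewrite ?mulr0n ?mulr1n; ring.
  by rewrite ?mulr0n ?mulr1n; ring.
have : (Q - (1 + 'X ^+ 2) ^+ #|I| * (T f)%:P)`_1 = 0 by rewrite Q0 coef0.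
(* A power of 1 + X^2 has no term of degree one. *)
have -> : (Q - (1 + 'X ^+ 2) ^+ #|I| * (T f)%:P)`_1 = Q`_1.
  rewrite coefB coefMC -prodr_const coef1_prod big1 ?mul0r ?subr0 // => r _.
  by rewrite coefD coef1 coefXn /= addr0 mul0r.
rewrite /Q coef_sum; under eq_bigr => g _ do rewrite coefMC coef1_prod mulr_suml.
rewrite exchange_big /=.
under eq_bigr => r _.
  under eq_bigr => g _.
    rewrite N1; under eq_bigr => s _ do rewrite N0.
    over.
  rewrite (sum_upd T (fun v => 2 * ((v == a)%:R * (f r == b)%:R -
                                    (v == b)%:R * (f r == a)%:R))).
  over.
have delta_sum c (F : 'I_n -> R) : \sum_v (v == c)%:R * F v = F c.
  rewrite (bigD1 c) //= eqxx mul1r big1 ?addr0 // => v /negPf ->.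
  by rewrite mul0r.
under eq_bigr => r _.
  under eq_bigr => v _ do rewrite -mulrA mulrBl -!mulrA.
  rewrite -mulr_sumr sumrB !delta_sum.
  over.
rewrite -mulr_sumr sumrB => /eqP.
rewrite mulf_eq0 (negPf (_ : 2 != 0)) ?pnatr_eq0 //= subr_eq0 => /eqP H.
exact/esym.
Qed.
End FFT.

Lemma upd_id (I : finType) (A : Type) (f : {ffun I -> A}) r : upd f r (f r) = f.
Proof. by apply/ffunP=> x; rewrite ffunE; case: eqP => [->|]. Qed.

Lemma upd_upd (I : finType) (A : Type) (f : {ffun I -> A}) r a b :
  upd (upd f r a) r b = upd f r b.
Proof. by apply/ffunP=> x; rewrite !ffunE; case: eqP. Qed.

(** * Invariant tensors all of whose contractions vanish *)

Section Traceless.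
Variables (R : realFieldType) (n : nat) (I : finType).
Implicit Types (T F G : {ffun I -> 'I_n} -> R) (f : {ffun I -> 'I_n}).

Definition contraction T r s f := \sum_a T (upd (upd f r a) s a).

(** At a fixed position, overwriting the entry [b] by [a] is a bijection between the indices
    carrying [b] and those carrying [a]; it transposes E_ab. *)
Lemma replace_index_adjoint F G a b :
  \sum_f F f * replace_index G a b f = \sum_f replace_index F b a f * G f.
Proof.
under eq_bigr => f _ do rewrite mulr_sumr.
under [RHS]eq_bigr => f _ do rewrite mulr_suml.
rewrite exchange_big [RHS]exchange_big; apply: eq_bigr => r _ /=.
rewrite (bigID (fun f => f r == a)) /= [X in _ + X]big1 ?addr0; last first.
  by move=> f /negPf ->; rewrite mul0r mulr0.
rewrite [RHS](bigID (fun f => f r == b)) /= [X in _ = _ + X]big1 ?addr0; last first.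
  by move=> f /negPf ->; rewrite !mul0r.
rewrite (reindex_onto (fun f => upd f r a) (fun f => upd f r b)) /=; last first.
  by move=> f /eqP <-; rewrite upd_upd upd_id.
apply: eq_big => f.
  rewrite ffunE !eqxx upd_upd /=; apply/eqP/eqP => [<-|<-].
    by rewrite ffunE eqxx.
  by rewrite upd_id.
case/andP=> _ /eqP fE; have fb : f r = b by rewrite -fE ffunE eqxx.
by rewrite fE fb ffunE !eqxx !mul1r.
Qed.

Lemma traceless_invariant_eq0 T :
  tensor_invariant T -> (forall r s f, r != s -> contraction T r s f = 0) ->
  (0 < #|I|)%N -> forall f, T f = 0.
Proof.
move=> Tinv Tc I0 f.
pose c f := \sum_r \sum_(s | s != r) (f r == f s)%:R : R.
(* Once [a] has been replaced by [b] at [r], the entry there differs from [a], so the second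
   replacement acts elsewhere. *)
have rr f' a b : a != b -> replace_index (replace_index T a b) a b f' =
    \sum_r \sum_(s | s != r) (f' r == a)%:R * (f' s == a)%:R *
       T (upd (upd f' r b) s b).
  move=> ab; apply: eq_bigr => r _; rewrite mulr_sumr (bigD1 r) //=.
  rewrite ffunE eqxx (eq_sym b) (negPf ab) mul0r mulr0 add0r.
  by apply: eq_bigr => s sr; rewrite ffunE (negPf sr) mulrA.
(* Pairing this with [T] gives sum_{a <> b} |A_ab T|^2 + sum_f c(f) T(f)^2 = 0. *)
have E f' : \sum_a \sum_(b | b != a) replace_index (replace_index T a b) a b f' +
    c f' * T f' = 0.
  (* Only [a = f' r = f' s] contributes, and there the updates leave [f'] unchanged. These terms
     fill the gap [b = a], and the completed sum over [b] is a contraction. *)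
  rewrite [X in _ + X](_ : _ = \sum_a \sum_r \sum_(s | s != r)
    (f' r == a)%:R * (f' s == a)%:R * T (upd (upd f' r a) s a)); last first.
    rewrite exchange_big mulr_suml; apply: eq_bigr => r _ /=.
    rewrite exchange_big mulr_suml; apply: eq_bigr => s sr /=.
    rewrite (bigD1 (f' r)) //= big1 ?addr0 => [|a /negPf ar]; last first.
      by rewrite eq_sym ar !mul0r.
    rewrite eqxx mul1r upd_id eq_sym; case: eqP => [<-|]; rewrite ?mul0r //.
    by rewrite upd_id.
  rewrite -big_split /= big1 // => a _.
  under eq_bigr => b ba do rewrite rr 1?eq_sym //.
  set X := fun b => \sum_r \sum_(s | s != r) (f' r == a)%:R *
     (f' s == a)%:R * T (upd (upd f' r b) s b).
  transitivity (\sum_b X b); first by rewrite [RHS](bigD1 a) //= addrC.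
  rewrite exchange_big big1 // => r _; rewrite exchange_big big1 // => s sr.
  by rewrite -mulr_sumr [X in _ * X]Tc 1?eq_sym // mulr0.
have : \sum_a \sum_(b | b != a) \sum_f' replace_index T a b f' ^+ 2 +
    \sum_f' c f' * T f' ^+ 2 = 0.
  transitivity (\sum_f' T f' * (\sum_a \sum_(b | b != a)
      replace_index (replace_index T a b) a b f' + c f' * T f')); last first.
    by rewrite big1 // => f' _; rewrite E mulr0.
  under [RHS]eq_bigr => f' _ do rewrite mulrDr mulrCA.
  rewrite big_split; congr (_ + _); apply/esym.
  under eq_bigr => f' _ do rewrite mulr_sumr.
  rewrite exchange_big; apply: eq_bigr => a _ /=.
  under eq_bigr => f' _ do rewrite mulr_sumr.
  rewrite exchange_big; apply: eq_bigr => b ba /=.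
  rewrite replace_index_adjoint; apply: eq_bigr => f' _.
  by rewrite (replace_indexC f' Tinv ba).
have c_ge0 f' : 0 <= c f'.
  by apply: sumr_ge0 => r _; apply: sumr_ge0 => s _; rewrite ler0n.
move/eqP; rewrite paddr_eq0; first last.
- by apply: sumr_ge0 => f' _; rewrite mulr_ge0 ?sqr_ge0.
- by do 3![apply: sumr_ge0 => ? _]; rewrite sqr_ge0.
case/andP=> _; rewrite psumr_eq0; last by move=> f' _; rewrite mulr_ge0 ?sqr_ge0.
move/allP/(_ f (mem_index_enum f))/implyP/(_ isT).
rewrite mulf_eq0 sqrf_eq0 => /orP[|/eqP //].
rewrite /c psumr_eq0; last by move=> r _; apply: sumr_ge0 => s _; rewrite ler0n.
move=> /allP c0.
(* The vanishing of [c f] says that no two positions carry the same index. *)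
have f_inj : injective f.
  move=> r s frs; apply/eqP; apply/negPn/negP => rs.
  have /implyP/(_ isT) := c0 r (mem_index_enum r).
  rewrite psumr_eq0; last by move=> ? _; rewrite ler0n.
  move=> /allP/(_ s (mem_index_enum s)) /=.
  by rewrite eq_sym rs /= frs eqxx pnatr_eq0.
(* By injectivity, reversing the basis vector indexed by [f r] affects the factor at [r] only,
   whence T f = - T f. *)
have /card_gt0P[r _] := I0.
have := Tinv _ (reflection_orthogonal R (f r)) f.
under eq_bigr => g _.
  under eq_bigr => s _ do rewrite reflectionE.
  rewrite (bigD1 r) //=.
  rewrite (_ : \prod_(s | s != r) _ = \prod_(s | s != r) (f s == g s)%:R); last first.
    apply: eq_bigr => s sr; case: (eqVneq (f s) (g s)) => [<-|]; rewrite ?mul0r //.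
    by rewrite (inj_eq f_inj) (negPf sr) mulr0 subr0 mulr1.
  over.
rewrite (sum_upd T (fun v => (f r == v)%:R * (1 - 2 * (v == f r)%:R))).
rewrite (bigD1 (f r)) //= big1 ?addr0; last first.
  by move=> v vr; rewrite eq_sym (negPf vr) !mul0r.
rewrite eqxx upd_id mul1r mulr1 => /eqP.
rewrite -subr_eq0 -{2}[T f]mul1r -mulrBl mulf_eq0 => /orP[|/eqP //].
by rewrite addrAC subrr sub0r oppr_eq0 pnatr_eq0.
Qed.
End Traceless.

(** * Removing two positions from the index set *)

Section TwoPoints.
Variables (I : finType) (n : nat) (r s : I) (rs : r != s).
Notation J := {x : I | (x != r) && (x != s)}.

Definition extend_two (A : Type) (g : {ffun J -> A}) (a : A) : {ffun I -> A} :=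
  [ffun x => if insub x is Some y then g y else a].

Definition restrict_two (A : Type) (f : {ffun I -> A}) : {ffun J -> A} :=
  [ffun y => f (val y)].

Lemma extend_twoE A (g : {ffun J -> A}) a (y : J) : extend_two g a (val y) = g y.
Proof. by rewrite ffunE valK. Qed.

Lemma extend_two_l A (g : {ffun J -> A}) a : extend_two g a r = a.
Proof. by rewrite ffunE insubF // eqxx. Qed.

Lemma extend_two_r A (g : {ffun J -> A}) a : extend_two g a s = a.
Proof. by rewrite ffunE insubF // eqxx andbF. Qed.

Lemma two_pointsP (Q : I -> Prop) :
  Q r -> Q s -> (forall y : J, Q (val y)) -> forall x, Q x.
Proof.
move=> Qr Qs QJ x; case: (eqVneq x r) => [->//|xr].
case: (eqVneq x s) => [->//|xs].
have xJ : (x != r) && (x != s) by rewrite xr.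
exact: (QJ (exist _ x xJ)).
Qed.

Lemma restrict_twoK A (g : {ffun J -> A}) a : restrict_two (extend_two g a) = g.
Proof. by apply/ffunP=> y; rewrite ffunE extend_twoE. Qed.

Lemma extend_twoK A (f : {ffun I -> A}) :
  f s = f r -> extend_two (restrict_two f) (f r) = f.
Proof.
move=> fE; apply/ffunP; apply: two_pointsP => [||y].
- by rewrite extend_two_l.
- by rewrite extend_two_r.
- by rewrite extend_twoE ffunE.
Qed.

Lemma prod_two_points (R : comPzSemiRingType) (F : I -> R) :
  \prod_x F x = F r * F s * \prod_(y : J) F (val y).
Proof.
rewrite (bigD1 r) // (bigD1 s) 1?eq_sym //= mulrA; congr (_ * _).
rewrite -(big_sub_cond (fun x => (x != r) && (x != s)) xpredT).
by apply: eq_bigl => x; rewrite andbT.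
Qed.

Lemma sum_two_points (R : nmodType) (F : {ffun I -> 'I_n} -> R) :
  \sum_(f : {ffun I -> 'I_n} | f s == f r) F f =
  \sum_(g : {ffun J -> 'I_n}) \sum_a F (extend_two g a).
Proof.
rewrite pair_big /= (reindex_onto (fun p => extend_two p.1 p.2)
  (fun f => (restrict_two f, f r))) /=; last first.
  by move=> f /eqP /extend_twoK.
apply: eq_bigl => -[g a] /=.
by rewrite extend_two_l extend_two_r restrict_twoK !eqxx.
Qed.

End TwoPoints.

(** By induction on the number of positions: a contraction is again invariant and inherits the
    vanishing sums, hence is zero, and [traceless_invariant_eq0] applies. Pairings are given as
    involutions because [I] shrinks to a subtype. *)
Lemma invariant_eq0 (R : realFieldType) n (I : finType) (T : {ffun I -> 'I_n} -> R) :
  tensor_invariant T ->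
  (forall t : I -> I, involutive t -> (forall x, t x != x) ->
     \sum_(f : {ffun I -> 'I_n} | [forall x, f (t x) == f x]) T f = 0) ->
  forall f, T f = 0.
Proof.
have [m] := ubnP #|I|; elim: m I T => // m IH I T ltm Tinv T0.
have [I0|I0] := posnP #|I|.
  (* On the empty type [id] has no fixed point, and its sum is the single value of [T]. *)
  move=> f; have noI (x : I) : False by move/card0_eq: I0 => /(_ x).
  have fE (g : {ffun I -> 'I_n}) : g = f by apply/ffunP => x; case: (noI x).
  rewrite -(T0 id) //.
  rewrite (bigD1 f) /=; last by apply/forallP=> x; case: (noI x).
  by rewrite big1 ?addr0 // => g /andP[_]; rewrite (fE g) eqxx.
apply: traceless_invariant_eq0 => // r s f rs.
pose J := {x : I | (x != r) && (x != s)}.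
pose T' (g : {ffun J -> 'I_n}) := \sum_a T (extend_two g a).
transitivity (T' (restrict_two r s f)).
  apply: eq_bigr => a _; congr T; apply/ffunP.
  apply: (two_pointsP (r := r) (s := s)) => [||y].
  - by rewrite extend_two_l !ffunE eqxx if_same.
  - by rewrite extend_two_r !ffunE eqxx.
  - by rewrite extend_twoE !ffunE; case/andP: (valP y) => /negPf -> /negPf ->.
apply: IH => [|U [U1 U2] g|t tK tx].
- rewrite card_sig -ltnS (leq_trans _ ltm) // ltnS.
  apply: proper_card; apply/properP; split; first exact/fintype.subsetP.
  by exists r; rewrite // inE eqxx.
- rewrite [RHS](eq_bigr _ (fun a _ => esym (Tinv U (conj U1 U2) _))).
  rewrite exchange_big /=.
  (* The columns of [U] are orthonormal: the two contracted factors merge into a delta which forces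
     [h s = h r]. *)
  have UU (u v : 'I_n) : \sum_a U a u * U a v = (u == v)%:R.
    have := congr1 (fun A : 'M[R]_n => A u v) U2; rewrite !mxE => <-.
    by apply: eq_bigr => a _; rewrite mxE.
  under [RHS]eq_bigr => h _.
    under eq_bigr => a _.
      rewrite (prod_two_points rs) extend_two_l extend_two_r.
      under eq_bigr => y _ do rewrite extend_twoE.
      over.
    rewrite -!mulr_suml UU -mulrA; over.
  rewrite (bigID (fun h : {ffun I -> 'I_n} => h s == h r)) /=.
  rewrite [X in _ = _ + X]big1 ?addr0; last first.
    by move=> h; rewrite eq_sym => /negPf ->; rewrite mul0r.
  rewrite (sum_two_points r s); apply: eq_bigr => h _.
  rewrite mulr_sumr; apply: eq_bigr => a _.
  rewrite extend_two_l extend_two_r eqxx mul1r; congr (_ * _).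
  by apply: eq_bigr => y _; rewrite extend_twoE.
(* The pairing [t] of the remaining positions is completed by the pair {r, s}. *)
- pose t' (x : I) : I := if x == r then s else if x == s then r else
     if insub x is Some y then val (t y) else x.
  have t'r : t' r = s by rewrite /t' eqxx.
  have t's : t' s = r by rewrite /t' eqxx eq_sym (negPf rs).
  have t'J (y : J) : t' (val y) = val (t y).
    by rewrite /t' valK; case/andP: (valP y) => /negPf -> /negPf ->.
  transitivity (\sum_(f : {ffun I -> 'I_n} | [forall x, f (t' x) == f x]) T f);
    last first.
    apply: T0; apply: (two_pointsP (r := r) (s := s)) => [||y].
    + by rewrite t'r t's.
    + by rewrite t's t'r.
    + by rewrite !t'J tK.
    + by rewrite t'r eq_sym.
    + by rewrite t's.
    + by rewrite t'J (inj_eq val_inj).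
  rewrite [RHS](eq_bigl (fun f : {ffun I -> 'I_n} => (f s == f r) &&
     [forall y : J, f (val (t y)) == f (val y)])); last first.
    move=> h; apply/forallP/andP => [H|[sr /forallP H]].
      by rewrite -{1}t'r H; split=> //; apply/forallP => y; rewrite -t'J H.
    apply: (two_pointsP (r := r) (s := s)) => [||y].
    * by rewrite t'r.
    * by rewrite t's eq_sym.
    * by rewrite t'J.
  rewrite big_mkcondr (sum_two_points r s) [LHS]big_mkcond.
  apply: eq_bigr => g _ /=; rewrite -big_mkcond.
  case: ifP => /forallP H.
    rewrite big_mkcond; apply: eq_bigr => a _; rewrite ifT //.
    by apply/forallP=> y; rewrite !extend_twoE.
  rewrite big_mkcond big1 // => a _; rewrite ifF //; apply/negbTE/negP => /forallP H'.
  by apply: H => y; have := H' y; rewrite !extend_twoE.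
Qed.

(** * Pairings and coset representatives *)

Section PairPartitions.
Variable k : nat.
Local Notation point := 'I_(k.*2).
Implicit Types (s m : 'S_(k.*2)) (x y : point) (i j : 'I_k).

Lemma half_proof x : (x./2 < k)%N.
Proof.
rewrite -ltn_double (leq_ltn_trans _ (ltn_ord x)) //.
by rewrite -{2}(odd_double_half x) leq_addl.
Qed.

Definition half_pt x : 'I_k := Ordinal (half_proof x).

Lemma half_oddpt i : half_pt (oddpt i) = i.
Proof. by apply: val_inj; rewrite /= doubleK. Qed.

Lemma half_evenpt i : half_pt (evenpt i) = i.
Proof. by apply: val_inj; rewrite /= uphalf_double. Qed.

Lemma pointP x : x = oddpt (half_pt x) \/ x = evenpt (half_pt x).
Proof.
have := odd_double_half x; case: (odd x) => /= xE; [right|left];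
  by apply: val_inj; rewrite /= -{1}xE.
Qed.

Lemma oddpt_inj : injective (@oddpt k).
Proof. by move=> i j ij; rewrite -(half_oddpt i) ij half_oddpt. Qed.

Lemma evenpt_inj : injective (@evenpt k).
Proof. by move=> i j ij; rewrite -(half_evenpt i) ij half_evenpt. Qed.

Lemma oddpt_neq_evenpt i j : (oddpt i == evenpt j) = false.
Proof.
apply/negP=> /eqP/(congr1 (fun x => odd (val x))) /=.
by rewrite !odd_double.
Qed.

Definition std_pairing : 'S_(k.*2) := (\prod_(i < k) tperm (oddpt i) (evenpt i))%g.

Lemma std_pairingE i :
  std_pairing (oddpt i) = evenpt i /\ std_pairing (evenpt i) = oddpt i.
Proof.
have fix_pt x (r : seq 'I_k) : half_pt x \notin r ->
    (\prod_(i <- r) tperm (oddpt i) (evenpt i))%g x = x.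
  elim: r => [|j r IH]; first by rewrite big_nil perm1.
  rewrite inE negb_or big_cons permM => /andP[xj xr].
  rewrite tpermD ?IH //; apply: contraNneq xj => <-.
    by rewrite half_oddpt.
  by rewrite half_evenpt.
have H (r : seq 'I_k) : uniq r -> i \in r ->
    (\prod_(i <- r) tperm (oddpt i) (evenpt i))%g (oddpt i) = evenpt i /\
    (\prod_(i <- r) tperm (oddpt i) (evenpt i))%g (evenpt i) = oddpt i.
  elim: r => //= j r IH /andP[jr ur]; rewrite inE big_cons !permM.
  case: (eqVneq i j) => [ij|ij] /= ir.
    by rewrite ij tpermL tpermR !fix_pt // ?half_evenpt ?half_oddpt.
  have [IHo IHe] := IH ur ir.
  have eo j' i' : (evenpt j' == oddpt i') = false.
    by rewrite eq_sym oddpt_neq_evenpt.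
  rewrite !tpermD ?IHo ?IHe ?oddpt_neq_evenpt ?eo //.
    by rewrite (inj_eq evenpt_inj) eq_sym.
  by rewrite (inj_eq oddpt_inj) eq_sym.
by apply: H; rewrite ?index_enum_uniq ?mem_index_enum.
Qed.

Lemma std_oddpt i : std_pairing (oddpt i) = evenpt i.
Proof. by case: (std_pairingE i). Qed.

Lemma std_evenpt i : std_pairing (evenpt i) = oddpt i.
Proof. by case: (std_pairingE i). Qed.

(* The pairing {{s(1),s(2)},...,{s(2k-1),s(2k)}} as an involution. The group law
   of ['S_n] composes from left to right, so [s \op h] is [(h * s)%g] and
   [s^-1 \op t] is [(t * s^-1)%g] throughout. *)
Definition pairing s : 'S_(k.*2) := (std_pairing ^ s)%g.

Lemma pairing_oddpt s i : pairing s (s (oddpt i)) = s (evenpt i).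
Proof. by rewrite permJ std_oddpt. Qed.

Lemma pairing_evenpt s i : pairing s (s (evenpt i)) = s (oddpt i).
Proof. by rewrite permJ std_evenpt. Qed.

Lemma imageP s x : exists i, x = s (oddpt i) \/ x = s (evenpt i).
Proof.
exists (half_pt (s^-1%g x)).
by case: (pointP (s^-1%g x)) => <-; rewrite permKV; [left|right].
Qed.

Lemma pairingK s : involutive (pairing s).
Proof.
by move=> x; case: (imageP s x) => i [] ->;
  rewrite ?pairing_oddpt ?pairing_evenpt ?pairing_oddpt.
Qed.

Lemma pairing_neq s x : pairing s x != x.
Proof.
case: (imageP s x) => i [] ->.
  by rewrite pairing_oddpt (inj_eq perm_inj) eq_sym oddpt_neq_evenpt.
by rewrite pairing_evenpt (inj_eq perm_inj) oddpt_neq_evenpt.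
Qed.

Lemma mem_hyperoctahedral s :
  (s \in hyperoctahedral k) = (pairing s == std_pairing).
Proof.
apply/cent1P/eqP; rewrite /pairing /commute conjgE => H; first by rewrite -H mulKg.
by have := congr1 (mulg s) H; rewrite mulKVg -/std_pairing => ->.
Qed.

Lemma pairingM s t : pairing (s * t) = (pairing s ^ t)%g.
Proof. by rewrite /pairing conjgM. Qed.

(** Pairings are the orbits of the conjugation action, hence the cosets of the centralizer; in terms
    of composition these are the cosets tH. *)
Lemma eq_pairing s t :
  (pairing s == pairing t) = ((s * t^-1)%g \in hyperoctahedral k).
Proof.
rewrite mem_hyperoctahedral pairingM -[RHS](inj_eq (conjg_inj t)).
by rewrite -conjgM mulVg conjg1.
Qed.

Lemma pairing_hM (h : 'S_(k.*2)) s :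
  h \in hyperoctahedral k -> pairing (h * s) = pairing s.
Proof. by move=> hH; apply/eqP; rewrite eq_pairing mulgK. Qed.

(** Being constant on the pairs of [s] is being invariant under the involution, so [delta'] depends
    on the pairing only. *)
Lemma delta'E (C : comPzSemiRingType) n s (f : point -> 'I_n) :
  delta' C s f = [forall x, f (pairing s x) == f x]%:R.
Proof.
rewrite /delta'; case: forallP => [H|/forallP].
  by apply: big1 => i _; rewrite -pairing_oddpt eq_sym (eqP (H _)) eqxx.
rewrite negb_forall => /existsP[x]; case: (imageP s x) => i [] ->.
  rewrite pairing_oddpt eq_sym => /negPf H.
  by rewrite (bigD1 i) //= H mul0r.
rewrite pairing_evenpt => /negPf H.
by rewrite (bigD1 i) //= H mul0r.
Qed.

(** * The canonical permutation of a pairing *)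

Section MinimaEnumeration.
Variables (t : point -> point) (tK : involutive t) (t_neq : forall x, t x != x).

Definition pair_minima : {set point} := [set x : point | (x < t x)%N]%SET.

Lemma mem_pair_minima x : (t x \in pair_minima) = (x \notin pair_minima).
Proof. by rewrite !inE tK ltnNge [in RHS]ltn_neqAle -(eq_sym (t x : nat)) t_neq. Qed.

Lemma card_pair_minima : #|pair_minima| = k.
Proof.
have : (#|pair_minima| + #|~: pair_minima| = k.*2)%N by rewrite cardsC card_ord.
rewrite (_ : ~: pair_minima = t @: pair_minima)%SET.
  rewrite card_imset; last exact: inv_inj.
  by rewrite addnn => /double_inj.
apply/setP=> x; rewrite inE; apply/idP/imsetP => [xA|[y yA ->]].
  by exists (t x); rewrite ?tK ?mem_pair_minima.
by rewrite -mem_pair_minima tK.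
Qed.

Definition nth_minimum i : point := enum_val (cast_ord (esym card_pair_minima) i).

Lemma nth_minimum_mem i : (nth_minimum i < t (nth_minimum i))%N.
Proof. by have := enum_valP (cast_ord (esym card_pair_minima) i); rewrite inE. Qed.

Lemma nth_minimumP x : (x < t x)%N -> exists i, x = nth_minimum i.
Proof.
move=> xt; have xA : x \in pair_minima by rewrite inE.
exists (cast_ord card_pair_minima (enum_rank_in xA x)).
by rewrite /nth_minimum cast_ord_comp cast_ord_id enum_rankK_in.
Qed.

Lemma nth_minimum_lt i j : (i < j)%N -> (nth_minimum i < nth_minimum j)%N.
Proof.
move=> ij; have x0 := nth_minimum i.
have sA : sorted (relpre val ltn) (enum pair_minima).
  rewrite -sorted_map; apply: (subseq_sorted ltn_trans _ (iota_ltn_sorted 0 k.*2)).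
  by rewrite -val_enum_ord map_subseq // enumT filter_subseq.
rewrite /nth_minimum !(enum_val_nth x0).
have tr : transitive (relpre val ltn : rel point) by move=> ? ? ?; apply: ltn_trans.
by apply: (sorted_ltn_nth tr x0 sA) => //; rewrite inE -cardE ltn_ord.
Qed.

Lemma nth_minimum_inj : injective nth_minimum.
Proof. by move=> i j /enum_val_inj/cast_ord_inj. Qed.

(** The pairs are listed by increasing minimum and the i-th one is placed at 2i, 2i+1. As points are
    numbered from 0, the second point of a pair sits at an odd ordinal. *)
Definition pairing_rep_fun x : point :=
  let m := nth_minimum (half_pt x) in if odd x then t m else m.

Lemma pairing_rep_oddpt i : pairing_rep_fun (oddpt i) = nth_minimum i.
Proof. by rewrite /pairing_rep_fun half_oddpt /= odd_double. Qed.

Lemma pairing_rep_evenpt i : pairing_rep_fun (evenpt i) = t (nth_minimum i).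
Proof. by rewrite /pairing_rep_fun half_evenpt /= odd_double. Qed.

Lemma pairing_rep_inj : injective pairing_rep_fun.
Proof.
have neq i j : nth_minimum i <> t (nth_minimum j).
  move=> E; have := nth_minimum_mem i.
  by rewrite E tK ltnNge ltnW // nth_minimum_mem.
move=> x y; case: (pointP x) => ->; case: (pointP y) => ->;
  rewrite ?pairing_rep_oddpt ?pairing_rep_evenpt.
- by move/nth_minimum_inj ->.
- by move/neq.
- by move/esym/neq.
- by move/(inv_inj tK)/nth_minimum_inj ->.
Qed.

Lemma pair_partition_exists :
  exists2 m, m \in pair_partitions k & pairing m =1 t.
Proof.
pose m := perm pairing_rep_inj.
have mo i : m (oddpt i) = nth_minimum i by rewrite permE pairing_rep_oddpt.
have me i : m (evenpt i) = t (nth_minimum i) by rewrite permE pairing_rep_evenpt.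
exists m; last first.
  move=> x; case: (imageP m x) => i [] ->.
    by rewrite pairing_oddpt me mo.
  by rewrite pairing_evenpt me mo tK.
rewrite inE; apply/and3P; split.
(* The point 0 is a minimum, and it comes first because the enumeration is increasing. *)
- apply/forallP=> i; apply/implyP=> /eqP i0.
  have k0 : (0 < k.*2)%N by rewrite double_gt0 (leq_ltn_trans _ (ltn_ord i)).
  pose z : point := Ordinal k0.
  have /nth_minimumP[j zj] : (z < t z)%N.
    by rewrite lt0n; apply: contra (t_neq z) => /eqP tz; apply/eqP/val_inj.
  rewrite mo; have [ij|] := ltnP i j.
    by have := nth_minimum_lt ij; rewrite -zj.
  rewrite i0 leqn0 => /eqP j0; rewrite (_ : i = j) -?zj //.
  by apply: val_inj; exact: etrans i0 (esym j0).
- apply/forallP=> i; apply/forallP=> j; apply/implyP => ij.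
  by rewrite !mo nth_minimum_lt.
- by apply/forallP=> i; rewrite mo me nth_minimum_mem.
Qed.

End MinimaEnumeration.

(** The images of the [oddpt i] are the minima of the pairs in increasing order, so the pairing
    determines them; the images of the [evenpt i] are their partners. *)
Lemma pair_partition_inj m m' : m \in pair_partitions k ->
  m' \in pair_partitions k -> pairing m = pairing m' -> m = m'.
Proof.
have lt_pair s i : s \in pair_partitions k -> (s (oddpt i) < s (evenpt i))%N.
  by rewrite inE => /and3P[_ _ /forallP].
have sM s : s \in pair_partitions k -> sorted ltn [seq val (s (oddpt i)) | i <- enum 'I_k].
  rewrite inE => /and3P[_ /forallP H _].
  rewrite (map_comp val (fun i => s (oddpt i))) sorted_map sorted_map.
  apply: (sub_sorted (e := relpre val ltn)) => [i j ij|].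
    by have /forallP/(_ j)/implyP := H i; apply.
  by rewrite -sorted_map val_enum_ord iota_ltn_sorted.
have mem_s s : s \in pair_partitions k -> forall x,
    (val x \in [seq val (s (oddpt i)) | i <- enum 'I_k]) = (x < pairing s x)%N.
  move=> sP x; apply/mapP/idP => [[i _ /val_inj ->]|].
    by rewrite pairing_oddpt lt_pair.
  case: (imageP s x) => i [] ->.
    by move=> _; exists i => //; rewrite mem_enum.
  by rewrite pairing_evenpt ltnNge ltnW // lt_pair.
move=> mP m'P E.
have /eq_in_map mo : [seq val (m (oddpt i)) | i <- enum 'I_k] =
    [seq val (m' (oddpt i)) | i <- enum 'I_k].
  apply: (irr_sorted_eq ltn_trans ltnn (sM _ mP) (sM _ m'P)) => v.
  apply/idP/idP => /mapP[i _ ->].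
    by rewrite mem_s // -E pairing_oddpt lt_pair.
  by rewrite mem_s // E pairing_oddpt lt_pair.
have {}mo i : m (oddpt i) = m' (oddpt i) by apply/val_inj/mo; rewrite mem_enum.
apply/permP=> x; case: (pointP x) => -> //.
by rewrite -!pairing_oddpt E mo.
Qed.

(** Each coset has exactly one representative in [pair_partitions k]. Sums over M_2k thereby become
    sums over the group, which can be reindexed by translations. *)
Lemma sum_pair_partitions (V : nmodType) (F : 'S_(k.*2) -> V) :
  (forall h s, h \in hyperoctahedral k -> F (h * s)%g = F s) ->
  \sum_s F s = (\sum_(s in pair_partitions k) F s) *+ #|hyperoctahedral k|.
Proof.
move=> FH.
(* The default [1] never occurs, by [pair_partition_exists]. *)
pose rep s := odflt 1%g [pick m in pair_partitions k | pairing m == pairing s].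
have repP s : (rep s \in pair_partitions k) && (pairing (rep s) == pairing s).
  rewrite /rep; case: pickP => [//|no].
  have [m mP mE] := pair_partition_exists (pairingK s) (pairing_neq s).
  by have := no m; rewrite mP /=; case/eqP; apply/permP.
rewrite (partition_big rep (mem (pair_partitions k))) /=; last first.
  by move=> s _; case/andP: (repP s).
rewrite -sumrMnl; apply: eq_bigr => m mP.
(* The fibre of [rep] over [m] is the coset of [m], parametrized by [h * m]. *)
rewrite (reindex_inj (mulIg m)) -sumr_const; apply: eq_big => h.
  have /andP[rP /eqP rE] := repP (h * m)%g.
  rewrite -[in RHS](mulgK m h) -eq_pairing -rE.
  by apply/eqP/eqP => [->//|]; apply: pair_partition_inj.
move=> /eqP hm; rewrite FH // -(mulgK m h) -eq_pairing -[X in _ == pairing X]hm eq_sym.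
by case/andP: (repP (h * m)%g).
Qed.

End PairPartitions.

(** * Two pairings: components and exchange *)

Section TwoPairings.
Variables (I : finType) (a b : {perm I}).
Hypotheses (aK : involutive a) (bK : involutive b).
Hypotheses (a_neq : forall x, a x != x) (b_neq : forall x, b x != x).

Let c : {perm I} := (a * b)%g.
Let e : rel I := fun x y => (y == a x) || (y == b x).

Let cE x : c x = b (a x). Proof. exact: permM. Qed.

Let cVE x : (c^-1)%g x = a (b x).
Proof. by apply: (perm_inj (s := c)); rewrite permKV cE aK bK. Qed.

Let porbit_step x : porbit c (c x) = porbit c x.
Proof. by have := porbit_perm c 1 x; rewrite expg1. Qed.

(** [a] and [b] generate a dihedral group, in which conjugation by [a] inverts [c]. *)
Lemma pairing_conj_expn i x : a ((c ^+ i)%g x) = (c ^- i)%g (a x).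
Proof.
rewrite -permJ conjXg -expgVn; congr (fun_of_perm _ _); congr (_ ^+ _)%g.
apply/permP=> y; rewrite cVE -[y in LHS](aK y) permJ cE.
by rewrite aK.
Qed.

Let e_sym : connect_sym e.
Proof.
apply: sym_connect_sym => x y; rewrite /e.
have sw (s : {perm I}) : involutive s -> (y == s x) = (x == s y).
  by move=> sK; apply/eqP/eqP => ->; rewrite sK.
by rewrite !sw.
Qed.

Definition component_root x := fingraph.root e x.
Local Notation root := component_root.

Lemma component_rootP x y :
  (root x == root y) = connect (fun x y => (y == a x) || (y == b x)) x y.
Proof. exact: fingraph.root_connect. Qed.

Lemma component_root_l x : root (a x) = root x.
Proof. by apply/esym/(fingraph.rootP e_sym)/connect1; rewrite /e eqxx. Qed.

Lemma component_root_r x : root (b x) = root x.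
Proof. by apply/esym/(fingraph.rootP e_sym)/connect1; rewrite /e eqxx orbT. Qed.

Lemma component_root_expn i x : root ((c ^+ i)%g x) = root x.
Proof.
elim: i => [|i IH]; first by rewrite perm1.
by rewrite expgSr permM cE component_root_r component_root_l.
Qed.

Lemma component_root_idem x : root (root x) = root x.
Proof. exact: root_root. Qed.

(** If [a x] were c^i x, then [a] would fix c^(i/2) x for even i, and [b] would fix c^((i+1)/2) x
    for odd i. *)
Lemma pairing_notin_porbit x : a x \notin porbit c x.
Proof.
apply/negP => /porbitP[i ax].
have := odd_double_half i; set l := i./2; case: (odd i) => /= iE.
  have : b ((c ^+ l.+1)%g x) = (c ^+ l.+1)%g x.
    rewrite {2}expgSr permM cE pairing_conj_expn ax -iE -addnn addnA.
    by rewrite expgD permM permK add1n.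
  by move/eqP; rewrite (negPf (b_neq _)).
have : a ((c ^+ l)%g x) = (c ^+ l)%g x.
  by rewrite pairing_conj_expn ax -iE add0n -addnn expgD permM permK.
by move/eqP; rewrite (negPf (a_neq _)).
Qed.

(* Each component is the disjoint union of two [c]-orbits exchanged by [a] and by
   [b]; this set contains one of them, so it meets every edge in one point. *)
Definition half_component : {set I} := [set x | x \in porbit c (root x)]%SET.
Local Notation S := half_component.

Lemma half_componentP x :
  reflect (exists i, x = (c ^+ i)%g (root x)) (x \in S).
Proof. by rewrite inE; apply: porbitP. Qed.

Lemma porbit_half_component x y : x \in S -> y \in S ->
  (x \in porbit c y) = (root x == root y).
Proof.
rewrite -eq_porbit_mem !inE -!eq_porbit_mem => /eqP -> /eqP ->.
apply/idP/eqP => [|-> //].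
rewrite eq_porbit_mem => /porbitP[i ri].
by rewrite -(component_root_idem x) ri component_root_expn component_root_idem.
Qed.

(** The orbit of the root and its image under [a] are disjoint, and their union is closed under [a]
    and [b], hence is the whole component. *)
Lemma mem_half_component_l x : (a x \in S) = (x \notin S).
Proof.
rewrite !inE component_root_l; apply/idP/idP => [axr|].
  apply/negP => xr; have := pairing_notin_porbit x.
  move: axr xr; rewrite -!eq_porbit_mem => /eqP axr /eqP xr.
  by rewrite axr xr eqxx.
suff: (x \in porbit c (root x)) || (a x \in porbit c (root x)).
  by case/orP => // ->.
pose A := [pred y | (y \in porbit c (root x)) || (a y \in porbit c (root x))].
have cmem y : (c y \in porbit c (root x)) = (y \in porbit c (root x)).
  by rewrite -!eq_porbit_mem porbit_step.
have cl : fingraph.closed e A.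
  apply: intro_closed => // y z /orP[] /eqP ->; rewrite !inE ?aK; first by rewrite orbC.
  case/orP=> H; last by rewrite -{1}(aK y) -cE cmem H.
  by rewrite -(cmem (a _)) -cVE permKV H orbT.
have rx : connect e (root x) x by rewrite e_sym connect_root.
by have := closed_connect cl rx; rewrite !inE porbit_id => <-.
Qed.

Lemma mem_half_component_r x : (b x \in S) = (x \notin S).
Proof.
have -> : (b x \in S) = (a x \in S).
  rewrite -{1}(aK x) -cE !inE cE component_root_r -cE !component_root_l.
  by rewrite -!eq_porbit_mem porbit_step.
exact: mem_half_component_l.
Qed.

(* On a component with root [r], the exchange constructed below fixes [r] and
   reverses the cycle r, a r, b (a r), a (b (a r)), ... *)
Let neg y :=
  if [pick i : 'I_#[c]%g | y == (c ^+ i)%g (root y)] is Some i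
  then (c ^- i)%g (root y) else y.

Let negE i x : root x = x -> neg ((c ^+ i)%g x) = (c ^- i)%g x.
Proof.
move=> rx; rewrite /neg component_root_expn rx.
have lt_i : (i %% #[c]%g < #[c]%g)%N by rewrite ltn_mod order_gt0.
case: pickP => [j /eqP|/(_ (Ordinal lt_i))]; last first.
  by rewrite /= expg_mod_order eqxx.
move=> E; apply: (perm_inj (s := (c ^+ i)%g)); rewrite permKV.
apply: (perm_inj (s := (c ^+ j)%g)); rewrite -E.
by rewrite -permM -expgD addnC expgD permM permKV.
Qed.

(** On the half component [g] is [neg]; elsewhere the first relation leaves no choice. The second
    relation follows because [neg] turns [c] into its inverse. *)
Lemma pairing_exchange :
  exists g : {perm I}, (forall x, g (a x) = b (g x)) /\ (forall x, g (b x) = a (g x)).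
Proof.
pose g x := if x \in S then neg x else b (neg (a x)).
have ga x : g (a x) = b (g x).
  by rewrite /g mem_half_component_l aK; case: (x \in S).
(* Finite order turns negative powers of [c] into natural ones, as [half_componentP] requires. *)
have [l cl] : exists l, (c^-1)%g = (c ^+ l)%g.
  by exists #[c]%g.-1; rewrite invg_expg.
have gb_S x : x \in S -> g (b x) = a (g x).
  move=> xS; rewrite /g mem_half_component_r xS /= -cVE.
  case/half_componentP: xS => i ->; set r := root x.
  have rr : root r = r by rewrite component_root_idem.
  rewrite -permM {1}cl -expgD addnC negE // negE // expgD invMg -cl invgK permM.
  by rewrite cE bK.
have gb x : g (b x) = a (g x).
  case: (boolP (x \in S)) => [/gb_S //|]; rewrite -mem_half_component_r => bxS.
  by rewrite -{2}(bK x) (gb_S _ bxS) aK.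
have negS x : x \in S -> neg x \in S /\ neg (neg x) = x.
  case/half_componentP=> i ->; set r := root x.
  have rr : root r = r by rewrite component_root_idem.
  have -> : neg ((c ^+ i)%g r) = (c ^+ (l * i))%g r.
    by rewrite negE // expgM -cl expgVn.
  split; first by apply/half_componentP; exists (l * i)%N; rewrite component_root_expn rr.
  by rewrite negE // expgM -cl expgVn invgK.
have gS x : (g x \in S) = (x \in S).
  rewrite /g; case: (boolP (x \in S)) => [/negS[]//|xS].
  rewrite mem_half_component_r; apply/negbTE/negPn.
  by apply: (negS (a x) _).1; rewrite mem_half_component_l.
have g_injS x y : x \in S -> y \in S -> g x = g y -> x = y.
  move=> xS yS; rewrite /g xS yS => E.
  by rewrite -(negS x xS).2 E (negS y yS).2.
have g_inj : injective g.
  move=> x y E; have := gS x; rewrite E gS; case: (boolP (x \in S)) => xS yS.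
    exact: g_injS.
  apply: (inv_inj aK); apply: g_injS; rewrite ?mem_half_component_l ?xS ?yS //.
  by rewrite !ga E.
by exists (perm g_inj); split=> x; rewrite !permE.
Qed.

End TwoPairings.

(** * Traces indexed by coset-types *)

(** Distributivity: a function on [J] is a family of functions on the blocks. A function on a block
    is encoded as one on [J] with the value [a0] off the block. *)
Lemma sum_prod_partition (R : comPzSemiRingType) (J A : finType) (a0 : A)
    (P : {set {set J}}) (Phi : {set J} -> {ffun J -> A} -> R) :
  finset.partition P [set: J] ->
  (forall (B : {set J}) (f g : {ffun J -> A}), {in B, f =1 g} -> Phi B f = Phi B g) ->
  \sum_(f : {ffun J -> A}) \prod_(B in P) Phi B f =
  \prod_(B in P) \sum_(f in pffun_on a0 (mem B) predT) Phi B f.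
Proof.
move=> partP PhiB; have [/eqP coverP trivP _] := and3P partP.
have inP x : x \in finset.cover P by rewrite coverP inE.
pose restr (B : {set J}) (f : {ffun J -> A}) : {ffun J -> A} :=
  [ffun x => if x \in B then f x else a0].
pose f0 : {ffun J -> A} := [ffun=> a0].
rewrite (big_distr_big_dep f0).
pose glue (F : {ffun {set J} -> {ffun J -> A}}) : {ffun J -> A} :=
  [ffun x => F (finset.pblock P x) x].
pose split_ (f : {ffun J -> A}) : {ffun {set J} -> {ffun J -> A}} :=
  [ffun B => if B \in P then restr B f else f0].
rewrite [RHS](reindex_onto split_ glue) /=; last first.
  move=> F /pfamilyP[/fintype.subsetP sF FP]; apply/ffunP=> B; rewrite ffunE.
  case: (boolP (B \in P)) => BP; last first.
    by apply/esym/eqP; apply: contraNT BP => ne; apply: sF; rewrite inE.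
  apply/ffunP=> x; rewrite !ffunE.
  have /pffun_onP[/fintype.subsetP sB _] := FP _ BP.
  case: ifPn => [xB|xB]; first by rewrite (finset.def_pblock trivP BP xB).
  by apply/esym/eqP; apply: contraNT xB => ne; apply: sB; rewrite inE.
apply: eq_big => f.
  apply/esym/andP; split.
    apply/pfamilyP; split.
      by apply/fintype.subsetP=> B; rewrite inE ffunE; case: ifP => //; rewrite eqxx.
    move=> B BP; rewrite ffunE BP; apply/pffun_onP; split=> //.
    by apply/fintype.subsetP=> x; rewrite inE ffunE; case: ifP => //; rewrite eqxx.
  apply/eqP/ffunP=> x; rewrite !ffunE finset.pblock_mem ?inP // ffunE.
  by rewrite finset.mem_pblock inP.
move=> _; apply: eq_bigr => B BP; rewrite ffunE BP; apply: PhiB => x xB.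
by rewrite ffunE xB.
Qed.

(** * Traces of powers as sums over closed walks *)

Section WalkSums.
Variables (R : comPzRingType) (n : nat) (A : 'M[R]_n).

Fixpoint walk_weight (u : 'I_n) (s : seq 'I_n) : R :=
  if s is v :: s' then A u v * walk_weight v s' else 1.

Lemma sum_tuple_cons (V : nmodType) m (F : seq 'I_n -> V) :
  \sum_(t : m.+1.-tuple 'I_n) F t =
  \sum_u \sum_(t : m.-tuple 'I_n) F (u :: t).
Proof.
rewrite pair_big /= (reindex (fun p : 'I_n * m.-tuple 'I_n => cons_tuple p.1 p.2)) //=.
exists (fun t : m.+1.-tuple 'I_n => (thead t, behead_tuple t)) => [[u t] _|t _] /=.
  by congr (_, _); apply: val_inj.
by case: (tupleP t) => u t'; apply: val_inj.
Qed.

Lemma sum_walks m u (F : 'I_n -> R) :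
  \sum_(t : m.-tuple 'I_n) walk_weight u t * F (last u t) =
  \sum_v (A ^+ m) u v * F v.
Proof.
elim: m u F => [|m IH] u F.
  rewrite (bigD1 [tuple]) //= big1 ?addr0 ?mul1r; last by move=> t /eqP[]; apply: tuple0.
  rewrite expr0 (bigD1 u) //= big1 ?addr0 ?mxE ?eqxx ?mul1r //.
  by move=> v vu; rewrite mxE eq_sym (negPf vu) mul0r.
rewrite (sum_tuple_cons _ (fun t => walk_weight u t * F (last u t))) /=.
under eq_bigr => v _.
  under eq_bigr => t _ do rewrite -mulrA.
  rewrite -mulr_sumr IH mulr_sumr; over.
rewrite exchange_big; apply: eq_bigr => v _ /=.
rewrite exprS -mulmxE mxE mulr_suml; apply: eq_bigr => w _; exact: mulrA.
Qed.

Lemma sum_closed_walks m :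
  \sum_u \sum_(t : m.-tuple 'I_n) walk_weight u t * A (last u t) u = \tr (A ^+ m.+1).
Proof.
apply: eq_bigr => u _; rewrite (sum_walks m u (fun v => A v u)).
by rewrite exprSr -mulmxE mxE.
Qed.

Lemma prod_traject (J : Type) (f : J -> 'I_n) (pi : J -> J) x m :
  \prod_(y <- traject pi x m.+1) A (f y) (f (pi y)) =
  walk_weight (f x) (map f (traject pi (pi x) m)) *
    A (last (f x) (map f (traject pi (pi x) m))) (f (iter m.+1 pi x)).
Proof.
elim: m x => [|m IH] x; first by rewrite big_seq1 /= mul1r.
by rewrite trajectS big_cons IH -iterSr /= mulrA.
Qed.

(** With the cycle listed from [x], a labelling of its points is a closed walk with one step per
    point. *)
Lemma sum_porbit (J : finType) (pi : {perm J}) (x : J) (a0 : 'I_n) :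
  \sum_(f in pffun_on a0 (mem (porbit pi x)) predT)
     \prod_(y in porbit pi x) A (f y) (f (pi y)) =
  \tr (A ^+ #|porbit pi x|).
Proof.
have m0 : (0 < #|porbit pi x|)%N by rewrite lt0n card_porbit_neq0.
have uT := uniq_traject_porbit pi x; have memT := porbit_traject pi x.
have itx := iter_porbit pi x.
move: m0 uT memT itx; case: #|porbit pi x| => // m _ uT memT itx.
rewrite -sum_closed_walks.
transitivity (\sum_(t : m.+1.-tuple 'I_n) walk_weight (head a0 t) (behead t) *
  A (last a0 t) (head a0 t)); last first.
  exact: (sum_tuple_cons m (fun t => walk_weight (head a0 t) (behead t) *
    A (last a0 t) (head a0 t))).
pose T := traject pi x m.+1.
have sT : size T = m.+1 by rewrite size_traject.
pose h (t : m.+1.-tuple 'I_n) : {ffun J -> 'I_n} := [ffun y => nth a0 t (index y T)].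
pose h' (f : {ffun J -> 'I_n}) : m.+1.-tuple 'I_n :=
  tcast sT (map_tuple f (in_tuple T)).
have h'E f : h' f = map f T :> seq _ by rewrite val_tcast.
rewrite (reindex_onto h h') /=; last first.
  move=> f /pffun_onP[/fintype.subsetP sf _]; apply/ffunP=> y; rewrite ffunE h'E.
  case: (boolP (y \in T)) => yT.
    by rewrite (nth_map y) ?index_mem // nth_index.
  rewrite nth_default; last by rewrite size_map leqNgt index_mem.
  apply/esym/eqP; apply: contraNT yT => ne.
  have yP : y \in porbit pi x by apply: sf.
  exact: etrans (esym (memT y)) yP.
apply: eq_big => t.
  apply/andP; split; first apply/pffun_onP.
    split=> //; apply/fintype.subsetP => y; rewrite inE ffunE; apply: contraNT.
    have -> : (y \in mem (porbit pi x)) = (y \in T) by exact: memT.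
    move=> yT.
    by rewrite nth_default // size_tuple -sT leqNgt index_mem.
  apply/eqP/val_inj; rewrite /= h'E.
  apply: (@eq_from_nth _ a0); rewrite ?size_map ?sT ?size_tuple // => l lm.
  by rewrite (nth_map x) ?sT // ffunE index_uniq ?sT.
case/andP=> _ /eqP ht.
rewrite (eq_bigl _ _ memT) -big_uniq //= prod_traject.
have {}itx : iter m.+1 pi x = x by [].
rewrite itx.
have -> : t = map (h t) T :> seq _ by rewrite -h'E ht.
by [].
Qed.

Lemma sum_perm_trace (J : finType) (pi : {perm J}) (a0 : 'I_n) :
  \sum_(f : {ffun J -> 'I_n}) \prod_x A (f x) (f (pi x)) =
  \prod_(B in porbits pi) \tr (A ^+ #|B|).
Proof.
have partP : finset.partition (porbits pi) [set: J].
  rewrite (_ : porbits pi =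
      finset.equivalence_partition (fun x y => y \in porbit pi x) [set: J]).
    apply: finset.equivalence_partitionP => x y z _ _ _; split; first exact: porbit_id.
    by rewrite -eq_porbit_mem eq_sym porbit_sym => /eqP xy; rewrite -!eq_porbit_mem xy.
  apply/setP=> B; apply/imsetP/imsetP => -[x _ ->]; exists x => //;
    by apply/setP=> y; rewrite !inE.
rewrite (eq_bigr (fun f : {ffun J -> 'I_n} =>
    \prod_(B in porbits pi) \prod_(x in B) A (f x) (f (pi x)))); last first.
  by move=> f _; rewrite -(finset.set_partition_big _ partP) /=; apply: eq_bigl => x; rewrite inE.
(* On a cycle the condition [porbit pi x == B] always holds; it makes the factor of an arbitrary set
   [B] depend only on the values on [B], as [sum_prod_partition] asks. *)
rewrite (eq_bigr (fun f : {ffun J -> 'I_n} =>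
    \prod_(B in porbits pi) \prod_(x in B | porbit pi x == B) A (f x) (f (pi x)))); last first.
  move=> f _; apply: eq_bigr => B /imsetP[y _ ->]; apply: eq_bigl => x.
  by rewrite eq_porbit_mem andbb.
rewrite (sum_prod_partition a0 (P := porbits pi) (Phi := fun B f =>
  \prod_(x in B | porbit pi x == B) A (f x) (f (pi x)))) //.
  apply: eq_bigr => B /imsetP[x _ ->]; rewrite -(sum_porbit pi x a0).
  apply: eq_bigr => f _; apply: eq_bigl => y.
  by rewrite eq_porbit_mem andbb.
move=> B f g fg; apply: eq_bigr => x /andP[xB /eqP xE].
by rewrite !fg // -xE -eq_porbit_mem -{2}[pi]expg1 porbit_perm.
Qed.

End WalkSums.

(** * Functions invariant under an involution *)

Section InvolutionTransversal.
Variables (I : finType) (t : I -> I) (S : {set I}).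
Hypotheses (tK : involutive t) (tS : forall x, (t x \in S) = (x \notin S)).
Local Notation J := {x : I | x \in S}.

Lemma fold_proof x : (if x \in S then x else t x) \in S.
Proof. by case: ifPn => //; rewrite tS. Qed.

Definition fold_pt x : J := exist (fun x => x \in S) _ (fold_proof x).

Definition unfold_fun (A : Type) (g : {ffun J -> A}) : {ffun I -> A} :=
  [ffun x => g (fold_pt x)].

Lemma unfold_fun_val A (g : {ffun J -> A}) (y : J) : unfold_fun g (val y) = g y.
Proof. by rewrite ffunE; congr (g _); apply: val_inj; rewrite /= (valP y). Qed.

Lemma unfold_fun_inv A (g : {ffun J -> A}) x : unfold_fun g (t x) = unfold_fun g x.
Proof.
rewrite !ffunE; congr (g _); apply: val_inj; rewrite /= tS.
by case: (x \in S) => //=; rewrite tK.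
Qed.

Lemma prod_involution (R : comPzSemiRingType) (F : I -> R) :
  \prod_x F x = \prod_(y : J) (F (val y) * F (t (val y))).
Proof.
rewrite big_split /= (bigID (mem S)) /=; congr (_ * _).
  exact: (big_sub (mem S)).
transitivity (\prod_(x in S) F (t x)); last exact: (big_sub (mem S)).
by rewrite (reindex_inj (inv_inj tK)); apply: eq_bigl => x; rewrite tS negbK.
Qed.

Lemma sum_involution_invariant (A : finType) (V : nmodType) (F : {ffun I -> A} -> V) :
  \sum_(f : {ffun I -> A} | [forall x, f (t x) == f x]) F f =
  \sum_(g : {ffun J -> A}) F (unfold_fun g).
Proof.
rewrite (reindex_onto (@unfold_fun A) (fun f => [ffun y => f (val y)])) /=; last first.
  move=> f /forallP fI; apply/ffunP=> x; rewrite !ffunE /=.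
  by case: ifP => // _; apply/eqP.
apply: eq_bigl => g; apply/andP; split.
  by apply/forallP=> x; rewrite unfold_fun_inv.
by apply/eqP/ffunP => y; rewrite ffunE unfold_fun_val.
Qed.

End InvolutionTransversal.

(** Both images are the quotient of [J] by the same equivalence relation. *)
Lemma prod_imset_eq (R : comPzSemiRingType) (J U V : finType) (f1 : J -> U) (f2 : J -> V)
    (G1 : U -> R) (G2 : V -> R) :
  (forall x y, (f1 x == f1 y) = (f2 x == f2 y)) ->
  (forall x, G1 (f1 x) = G2 (f2 x)) ->
  \prod_(u in f1 @: [set: J]) G1 u = \prod_(v in f2 @: [set: J]) G2 v.
Proof.
move=> f12 G12.
have [x0|J0] := pickP [pred x : J | true]; last first.
  rewrite !big1 // => u /imsetP[x _ _]; by have := J0 x.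
move=> _; pose h u := f2 (odflt x0 [pick x | f1 x == u]).
have hE x : h (f1 x) = f2 x.
  rewrite /h; case: pickP => [y|/(_ x)]; last by rewrite eqxx.
  by rewrite f12 => /eqP.
rewrite (_ : f2 @: _ = h @: (f1 @: [set: J])); last first.
  by rewrite -imset_comp; apply: eq_imset => x; rewrite /= hE.
rewrite [RHS]big_imset /=; first by apply: eq_bigr => _ /imsetP[x _ ->]; rewrite hE.
move=> _ _ /imsetP[x _ ->] /imsetP[y _ ->]; rewrite !hE => /eqP.
by rewrite -f12 => /eqP.
Qed.

(** * Contractions of the tensor powers of a matrix *)

Section TraceFormula.
Variables (R : comPzRingType) (k n p : nat) (X : 'M[R]_(n, p)) (s : 'S_(k.*2)).
Local Notation point := 'I_(k.*2).
Hypotheses (n_gt0 : (0 < n)%N).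
Let a := std_pairing k.
Let b := pairing s.
Let aE : a = pairing 1.
Proof. by rewrite /pairing conjg1. Qed.
Let aK : involutive a. Proof. by rewrite aE; apply: pairingK. Qed.
Let bK : involutive b. Proof. exact: pairingK. Qed.
Let a_neq x : a x != x. Proof. by rewrite aE; apply: pairing_neq. Qed.
Let b_neq x : b x != x. Proof. exact: pairing_neq. Qed.
Let S := half_component a b.
Let aS x : (a x \in S) = (x \notin S). Proof. exact: mem_half_component_l. Qed.
Let bS x : (b x \in S) = (x \notin S). Proof. exact: mem_half_component_r. Qed.
Local Notation J := {x : point | x \in S}.
Let Y := X *m X^T.

(** The half component meets each pair of [s] once, so [g] is free on it; summing over the common
    value on a pair gives an entry of X X^T. *)
Lemma sum_columns (f : {ffun point -> 'I_n}) :
  \sum_(g : {ffun point -> 'I_p} | [forall x, g (b x) == g x])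
     \prod_r X (f r) (g r) =
  \prod_(y : J) Y (f (val y)) (f (b (val y))).
Proof.
rewrite (sum_involution_invariant bK bS).
under eq_bigr => g _.
  rewrite (prod_involution bK bS).
  under eq_bigr => y _ do rewrite (unfold_fun_inv bK bS) unfold_fun_val.
  over.
rewrite -(bigA_distr_bigA (fun (y : J) v => X (f (val y)) v * X (f (b (val y))) v)).
by apply: eq_bigr => y _; rewrite mxE; apply: eq_bigr => v _; rewrite mxE.
Qed.

Let step_proof (y : J) : a (b (val y)) \in S.
Proof. by rewrite aS bS (valP y). Qed.

(** The inverse of [a * b]: two steps along the component, which lead back into the half
    component. *)
Let step (y : J) : J := exist (fun x => x \in S) _ (step_proof y).

Let step_inj : injective step.
Proof. by move=> x y [] /perm_inj/perm_inj/val_inj. Qed.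

Let pi : {perm J} := perm step_inj.

Let val_pi i (y : J) : val ((pi ^+ i)%g y) = ((a * b)^-1 ^+ i)%g (val y).
Proof.
elim: i => [|i IH]; first by rewrite !perm1.
rewrite !expgSr !permM permE /= IH.
by apply: (perm_inj (s := (a * b)%g)); rewrite permKV permM aK bK.
Qed.

Let mem_porbit_pi (x y : J) :
  (x \in porbit pi y) = (component_root a b (val x) == component_root a b (val y)).
Proof.
rewrite -porbit_half_component ?(valP x) ?(valP y) //.
rewrite -[in RHS]porbitV; apply/porbitP/porbitP => -[i xE]; exists i.
  by rewrite xE val_pi.
by apply: val_inj; rewrite val_pi.
Qed.

Let Gamma_connect : connect (Gamma s) =2 connect (fun x y => (y == a x) || (y == b x)).
Proof.
have set2E (x y u v : point) : u != v -> [set x; y]%SET == [set u; v]%SET ->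
    x = u /\ y = v \/ x = v /\ y = u.
  move=> uv /eqP/setP E; have := E u; have := E v; rewrite !inE !eqxx orbT /=.
  case/orP=> /eqP vE /orP[] /eqP uE; rewrite uE vE ?eqxx // in uv *.
    by right.
  by left.
apply: eq_connect => x y; apply/existsP/orP.
  case=> i /orP[] E.
    left; have := set2E _ _ _ _ _ E; rewrite oddpt_neq_evenpt => /(_ isT).
    by case=> [[-> ->]|[-> ->]]; rewrite ?std_oddpt ?std_evenpt.
  right; have := set2E _ _ _ _ _ E.
  rewrite (inj_eq perm_inj) oddpt_neq_evenpt => /(_ isT).
  by case=> [[-> ->]|[-> ->]]; rewrite /b ?pairing_oddpt ?pairing_evenpt.
case=> /eqP ->.
  exists (half_pt x); apply/orP; left; case: (pointP x) => {1 2}->.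
    by rewrite /a std_oddpt.
  by rewrite /a std_evenpt finset.setUC.
case: (imageP s x) => i [] ->; exists i; apply/orP; right.
  by rewrite /b pairing_oddpt.
by rewrite /b pairing_evenpt finset.setUC.
Qed.

Let component (y : J) := [set x | connect (Gamma s) (val y) x]%SET.

Let mem_component (y : J) x :
  (x \in component y) = (component_root a b x == component_root a b (val y)).
Proof. by rewrite inE Gamma_connect -(component_rootP aK bK) eq_sym. Qed.

Let Gamma_componentsE : Gamma_components s = component @: [set: J].
Proof.
apply/setP=> B; apply/imsetP/imsetP => [[x _ ->]|[y _ ->]]; last first.
  by exists (val y) => //; apply/setP=> z; rewrite !inE.
exists (fold_pt aS x) => //; apply/setP=> z; rewrite mem_component !inE /=.
rewrite Gamma_connect -(component_rootP aK bK) eq_sym; case: ifP => // _.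
by rewrite (component_root_l aK bK).
Qed.

(** The half component cuts a component into a cycle of [pi] and the image of this cycle under
    [a]. *)
Let card_component (y : J) : #|component y|./2 = #|porbit pi y|.
Proof.
have valE : component y :&: S = val @: porbit pi y.
  apply/setP=> x; rewrite inE mem_component; apply/andP/imsetP => [[xr xS]|[z zy ->]].
    by exists (exist (fun x => x \in S) x xS); rewrite // mem_porbit_pi.
  by rewrite -mem_porbit_pi zy; split=> //; apply: valP.
have aE' : component y :\: S = a @: (component y :&: S).
  apply/setP=> x; rewrite inE mem_component; apply/andP/imsetP => [[xS xr]|[z]].
    by exists (a x); rewrite ?aK // inE mem_component (component_root_l aK bK) xr aS.
  by rewrite inE mem_component => /andP[zr zS] ->; rewrite aS negbK (component_root_l aK bK).
rewrite -(cardsID S (component y)) aE' card_imset; last exact: perm_inj.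
by rewrite valE card_imset ?addnn ?doubleK //; apply: val_inj.
Qed.

Lemma Tr'E : Tr' s Y = \prod_(B in porbits pi) \tr (Y ^+ #|B|).
Proof.
rewrite /Tr' /coset_type (perm_big _ (permEl (perm_sort _ _))) big_map.
rewrite big_enum /= Gamma_componentsE /porbits.
rewrite -(prod_imset_eq (f1 := porbit pi) (G1 := fun B => \tr (Y ^+ #|B|))) => [|x y|y].
- by apply: eq_bigl => B; apply/imsetP/imsetP => -[x _ ->]; exists x.
- rewrite eq_porbit_mem mem_porbit_pi; apply/eqP/eqP => [E|/setP E].
    by apply/setP=> z; rewrite !mem_component E.
  by have := E (val x); rewrite !mem_component eqxx => /esym/eqP.
- by rewrite card_component.
Qed.

(** Summing out [g] leaves the product of the Y (f y) (f (b y)). As [f] is invariant under [a], f (b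
    y) is the value at [pi y], and the sum over [f] splits along the cycles of [pi]. *)
Lemma sum_delta'_Tr' :
  \sum_(f : {ffun point -> 'I_n}) \sum_(g : {ffun point -> 'I_p})
     delta' R 1%g f * delta' R s g * \prod_r X (f r) (g r) = Tr' s Y.
Proof.
have sum_delta m (u : 'S_(k.*2)) (F : {ffun point -> 'I_m} -> R) :
    \sum_(f : {ffun point -> 'I_m}) delta' R u f * F f =
    \sum_(f : {ffun point -> 'I_m} | [forall x, f (pairing u x) == f x]) F f.
  rewrite [RHS]big_mkcond; apply: eq_bigr => f _; rewrite delta'E.
  by case: ifP => _; rewrite ?mul1r ?mul0r.
under eq_bigr => f _.
  under eq_bigr => g _ do rewrite -mulrA.
  rewrite -mulr_sumr sum_delta sum_columns; over.
rewrite sum_delta -aE (sum_involution_invariant aK aS).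
rewrite Tr'E -(sum_perm_trace Y pi (Ordinal n_gt0)); apply: eq_bigr => f _.
apply: eq_bigr => y _; rewrite unfold_fun_val; congr (Y _ _).
have -> : pi y = step y by rewrite /pi permE.
rewrite -(unfold_fun_inv aK aS f (b _)).
exact: (unfold_fun_val aS f (step y)).
Qed.

End TraceFormula.

(** * The Hecke algebra and the Weingarten function *)

Section BiinvariantFunctions.
Variables (R : realType) (k : nat).
Local Notation S2k := 'S_(k.*2).
Local Notation H := (hyperoctahedral k).
Implicit Types (f g W : {ffun S2k -> R[i]}) (s t h : S2k).

Lemma biinvariantP f : biinvariant f <->
  (forall h s, h \in H -> f (h * s)%g = f s) /\
  (forall h s, h \in H -> f (s * h)%g = f s).
Proof.
split=> [fH|[fl fr] s h1 h2 h1H h2H]; last by rewrite /perm_op fl // fr.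
split=> h s hH; first by rewrite -(fH s 1%g h) // /perm_op mulg1.
by rewrite -(fH s h 1%g) // /perm_op mul1g.
Qed.

(** The convolution over the whole group, [t * s] being the composite of s after t; associativity is
    a reindexing here. *)
Definition convolution f g : {ffun S2k -> R[i]} :=
  [ffun s => \sum_t f (t * s)%g * g (t^-1)%g].

Lemma convolution_sharp f g : biinvariant f -> biinvariant g ->
  convolution f g = sharp f g *+ #|H|.
Proof.
move=> /biinvariantP[fl fr] /biinvariantP[gl gr].
apply/ffunP=> s; rewrite ffunMnE !ffunE.
apply: (sum_pair_partitions (F := fun t => f (t * s)%g * g (t^-1)%g)) => h t hH.
by rewrite /= -mulgA (fl h) // invMg gr // groupV.
Qed.

(* The permutation exchanging the pairings of [1] and of [s] shows that [s^-1]
   belongs to [H s H]. *)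
Lemma biinvariant_inv f s : biinvariant f -> f (s^-1)%g = f s.
Proof.
move=> /biinvariantP[fl fr].
pose a := std_pairing k; pose b := pairing s.
have aE : a = pairing 1 by rewrite /pairing conjg1.
have [] := @pairing_exchange _ a b.
- by rewrite aE; apply: pairingK.
- exact: pairingK.
- by move=> x; rewrite aE; apply: pairing_neq.
- exact: pairing_neq.
move=> g [ga gb].
have bE : b = (s^-1 * (a * s))%g by rewrite /b /pairing conjgE.
have ag : (a * g = g * b)%g by apply/permP=> x; rewrite [LHS]permM [RHS]permM ga.
have bg : (b * g = g * a)%g by apply/permP=> x; rewrite [LHS]permM [RHS]permM gb.
have h1H : (g * s^-1)%g \in H.
  rewrite mem_hyperoctahedral; apply/eqP; rewrite -[RHS](mulKg (g * s^-1)%g).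
  rewrite /pairing conjgE -/a; congr (_ * _)%g.
  by rewrite mulgA ag bE !mulgA mulgK.
have h2H : (s * g)%g \in H.
  rewrite mem_hyperoctahedral; apply/eqP; rewrite -[RHS](mulKg (s * g)%g).
  rewrite /pairing conjgE -/a; congr (_ * _)%g.
  by rewrite -mulgA -bg bE !mulgA mulgV mul1g.
transitivity (f ((g * s^-1)^-1 * (s^-1 * (s * g)))%g).
  by rewrite (fl (g * s^-1)^-1%g) ?groupV // fr.
by congr (f _); rewrite invMg invgK mulKg mulgKV.
Qed.

Lemma convolution_biinvariant f g : biinvariant f -> biinvariant g ->
  biinvariant (convolution f g).
Proof.
move=> /biinvariantP[fl fr] /biinvariantP[gl gr]; apply/biinvariantP.
split=> h s hH; rewrite !ffunE; last first.
  by apply: eq_bigr => t _; rewrite mulgA fr.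
rewrite (reindex_inj (mulIg h^-1%g)); apply: eq_bigr => t _.
by rewrite mulgA mulgKV invMg invgK gl.
Qed.

(** Gelfand's trick: inversion reverses convolutions and, by [biinvariant_inv], fixes every
    biinvariant function. *)
Lemma convolutionC f g : biinvariant f -> biinvariant g ->
  convolution f g = convolution g f.
Proof.
move=> fB gB; apply/ffunP=> s.
rewrite -(biinvariant_inv s (convolution_biinvariant fB gB)) !ffunE.
rewrite (reindex_inj (mulIg s)); apply: eq_bigr => t _.
by rewrite mulgK (biinvariant_inv _ gB) (biinvariant_inv _ fB) mulrC.
Qed.

Lemma convolutionA f g W :
  convolution (convolution f g) W = convolution f (convolution g W).
Proof.
apply/ffunP=> s; rewrite !ffunE.
under eq_bigr => t _ do rewrite ffunE mulr_suml.
under [RHS]eq_bigr => t _ do rewrite ffunE mulr_sumr.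
rewrite [RHS]exchange_big /=; apply: eq_bigr => t _.
rewrite [RHS](reindex_inj (mulIg t)); apply: eq_bigr => u _ /=.
by rewrite invMg mulKVg !mulgA mulrA.
Qed.

(** As kernels (r, t) -> f (t r^-1), functions on the group convolve like matrices. *)
Lemma convolution3E f g W r t :
  convolution (convolution f g) W (t * r^-1)%g =
  \sum_v \sum_w f (v * r^-1)%g * g (w * v^-1)%g * W (t * w^-1)%g.
Proof.
rewrite ffunE (reindex_inj (mulIg t^-1%g)) exchange_big /=; apply: eq_bigr => w _.
rewrite -mulr_suml invMg invgK; congr (_ * _); rewrite mulgA mulgKV ffunE.
rewrite (reindex_inj (mulIg w^-1%g)) /=; apply: eq_bigr => v _.
by rewrite invMg invgK mulgA mulgKV.
Qed.

Lemma card_hyperoctahedral_neq0 : #|H|%:R != 0 :> R[i].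
Proof. by rewrite pnatr_eq0 -lt0n cardG_gt0. Qed.

Lemma sharp_convolution f g : biinvariant f -> biinvariant g ->
  sharp f g = [ffun s => #|H|%:R^-1 * convolution f g s].
Proof.
move=> fB gB; rewrite convolution_sharp //; apply/ffunP=> s.
by rewrite [RHS]ffunE ffunMnE -(mulr_natl (sharp f g s)) mulKf // card_hyperoctahedral_neq0.
Qed.

Lemma biinvariantZ c f : biinvariant f -> biinvariant [ffun s => c * f s].
Proof. by move=> fB s h1 h2 h1H h2H; rewrite !ffunE fB. Qed.

Lemma convolutionZl c f g :
  convolution [ffun s => c * f s] g = [ffun s => c * convolution f g s].
Proof.
apply/ffunP=> s; rewrite !ffunE mulr_sumr; apply: eq_bigr => t _.
by rewrite ffunE mulrA.
Qed.

Lemma convolutionZr c f g :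
  convolution f [ffun s => c * g s] = [ffun s => c * convolution f g s].
Proof.
apply/ffunP=> s; rewrite !ffunE mulr_sumr; apply: eq_bigr => t _.
by rewrite ffunE mulrCA.
Qed.

Lemma sharp_biinvariant f g : biinvariant f -> biinvariant g ->
  biinvariant (sharp f g).
Proof.
move=> fB gB; rewrite sharp_convolution //.
exact/biinvariantZ/convolution_biinvariant.
Qed.

Lemma sharpC f g : biinvariant f -> biinvariant g -> sharp f g = sharp g f.
Proof. by move=> fB gB; rewrite !sharp_convolution // convolutionC. Qed.

Lemma sharpA f g W : biinvariant f -> biinvariant g -> biinvariant W ->
  sharp (sharp f g) W = sharp f (sharp g W).
Proof.
move=> fB gB WB; rewrite sharp_convolution //; last exact: sharp_biinvariant.
rewrite [RHS]sharp_convolution //; last exact: sharp_biinvariant.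
rewrite (sharp_convolution fB gB) (sharp_convolution gB WB).
by rewrite convolutionZl convolutionZr convolutionA.
Qed.

(** In this commutative algebra g f f = f makes g f an idempotent fixing f, and g f g is the
    generalized inverse. *)
Lemma generalized_inverse_exists f : biinvariant f ->
  (exists2 g, biinvariant g & sharp g (sharp f f) = f) ->
  exists W, [/\ biinvariant W, sharp (sharp f W) f = f & sharp (sharp W f) W = W].
Proof.
move=> fB [g gB gff].
have gfB : biinvariant (sharp g f) by apply: sharp_biinvariant.
have fgf : sharp (sharp f g) f = f by rewrite (sharpC fB gB) sharpA // gff.
have gfgf : sharp (sharp g f) (sharp g f) = sharp g f.
  by rewrite (sharpA gB fB gfB) -(sharpA fB gB fB) fgf.
exists (sharp (sharp g f) g); split; first exact: sharp_biinvariant.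
  by rewrite -(sharpA fB gfB gB) -(sharpA fB gB fB) fgf fgf.
by rewrite (sharpA gfB gB fB) gfgf -(sharpA gfB gfB gB) gfgf.
Qed.

End BiinvariantFunctions.

(** * The Gram matrix of the delta' and its symmetries *)

Section GramKernel.
Variables (R : comPzRingType) (k : nat).
Local Notation point := 'I_(k.*2).
Implicit Types (s t h : 'S_(k.*2)).

Definition precomp n s (f : {ffun point -> 'I_n}) : {ffun point -> 'I_n} :=
  [ffun x => f (s x)].

Lemma precomp_inj n s : injective (@precomp n s).
Proof.
move=> f g E; apply/ffunP=> x.
by have := congr1 (fun f : {ffun _} => f (s^-1 x)%g) E; rewrite !ffunE permKV.
Qed.

Lemma delta'_precomp n s t (f : {ffun point -> 'I_n}) :
  delta' R t (precomp s f) = delta' R (t * s)%g f.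
Proof. by apply: eq_bigr => r _; rewrite !ffunE !permM. Qed.

(** Relabelling the positions by [s] reduces to [sum_delta'_Tr']. *)
Lemma sum_delta'_Tr'_kernel n p (X : 'M[R]_(n, p)) s t : (0 < n)%N ->
  \sum_(f : {ffun point -> 'I_n}) \sum_(g : {ffun point -> 'I_p})
     delta' R s f * delta' R t g * \prod_r X (f r) (g r) =
  Tr' (t * s^-1)%g (X *m X^T).
Proof.
move=> n0; rewrite -(sum_delta'_Tr' X (t * s^-1)%g n0).
rewrite [RHS](reindex_inj (@precomp_inj n s)); apply: eq_bigr => f _.
rewrite [RHS](reindex_inj (@precomp_inj p s)); apply: eq_bigr => g _ /=.
rewrite !delta'_precomp mul1g mulgKV; congr (_ * _).
rewrite (reindex_inj (@perm_inj _ s)); apply: eq_bigr => r _.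
by rewrite !ffunE.
Qed.

Lemma delta'_hM n h s (f : {ffun point -> 'I_n}) : h \in hyperoctahedral k ->
  delta' R (h * s)%g f = delta' R s f.
Proof. by move=> hH; rewrite !delta'E pairing_hM. Qed.

(** In the kernel formula [h1] is absorbed by one [delta'], and [h2] moves over to the other one. *)
Lemma Tr'_biinvariant n p (X : 'M[R]_(n, p)) h1 h2 s : (0 < n)%N ->
  h1 \in hyperoctahedral k -> h2 \in hyperoctahedral k ->
  Tr' (h1 * s * h2)%g (X *m X^T) = Tr' s (X *m X^T).
Proof.
move=> n0 h1H h2H.
have := sum_delta'_Tr'_kernel X h2^-1 (h1 * s) n0.
have := sum_delta'_Tr'_kernel X 1 s n0.
rewrite invgK invg1 mulg1 => <- <-.
apply: eq_bigr => f _; apply: eq_bigr => g _.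
by rewrite delta'_hM // -[(h2^-1)%g]mulg1 delta'_hM ?groupV.
Qed.

Lemma Tr'1 n s : Tr' s (1%:M : 'M[R]_n) = n%:R ^+ kappa' s.
Proof.
rewrite /Tr' (eq_bigr (fun=> n%:R)); last first.
  by move=> m _; rewrite expr1n mxtrace1.
by rewrite big_const_seq count_predT size_sort size_map -cardE -Monoid.iteropE.
Qed.

(** The contraction formula for the identity matrix, whose entries force [f = g]. *)
Lemma gram_delta' n s t : (0 < n)%N ->
  \sum_(f : {ffun point -> 'I_n}) delta' R s f * delta' R t f =
  n%:R ^+ kappa' (t * s^-1)%g.
Proof.
move=> n0; rewrite -Tr'1 -[1%:M]mulmx1 -{2}[1%:M]trmx1 -sum_delta'_Tr'_kernel //.
apply: eq_bigr => f _; rewrite [RHS](bigD1 f) //= [X in _ * X + _]big1 => [|r _]; last first.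
  by rewrite mxE eqxx.
rewrite mulr1 [X in _ + X]big1 ?addr0 // => g gf.
have /existsP[r rf] : [exists r, f r != g r].
  apply: contraNT gf; rewrite negb_exists => /forallP H.
  by apply/eqP/ffunP=> r; apply/esym/eqP; have := H r; rewrite negbK.
by rewrite (bigD1 r) //= mxE (negPf rf) mul0r mulr0.
Qed.

Lemma natr_kappa'_biinvariant n h1 h2 s : (0 < n)%N ->
  h1 \in hyperoctahedral k -> h2 \in hyperoctahedral k ->
  n%:R ^+ kappa' (h1 * s * h2)%g = n%:R ^+ kappa' s :> R.
Proof.
move=> n0 h1H h2H; have := Tr'_biinvariant (1%:M : 'M[R]_n) s n0 h1H h2H.
by rewrite trmx1 mulmx1 !Tr'1.
Qed.

Lemma natr_kappa'_inv n s : (0 < n)%N ->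
  n%:R ^+ kappa' (s^-1)%g = n%:R ^+ kappa' s :> R.
Proof.
move=> n0.
have E t u : \sum_(f : {ffun point -> 'I_n}) delta' R t f * delta' R u f =
    \sum_(f : {ffun point -> 'I_n}) delta' R u f * delta' R t f.
  by apply: eq_bigr => f _; apply: mulrC.
have := E s 1%g; rewrite (gram_delta' s 1%g n0) (gram_delta' 1%g s n0).
rewrite mul1g invg1 mulg1 => H; exact: H.
Qed.

End GramKernel.

(** A vector v = yF killed by F satisfies v v^T = v F y^T = 0, hence is zero: F and F^2 have the
    same rank. *)
Lemma symmetric_submx_sqr (R : realFieldType) n (F : 'M[R]_n) :
  F^T = F -> (F <= F *m F)%MS.
Proof.
move=> FT; have FF : (F *m F <= F)%MS by apply: submxMl.
rewrite -(geq_leqif (mxrank_leqif_sup FF)) -{1}(mxrank_mul_ker F F).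
rewrite (_ : (F :&: kermx F)%MS = 0) ?mxrank0 ?addn0 //.
apply/eqP/rowV0P => v; rewrite sub_capmx => /andP[/submxP[y vE] /sub_kermxP vF].
have : (v *m v^T) 0 0 = 0.
  by rewrite {2}vE trmx_mul FT mulmxA vF mul0mx mxE.
rewrite mxE => /eqP; rewrite psumr_eq0; last first.
  by move=> j _; rewrite mxE -expr2 sqr_ge0.
move=> /allP v0; apply/rowP=> j; have := v0 j (mem_index_enum j).
by rewrite !mxE -expr2 sqrf_eq0 => /eqP.
Qed.

(** * Existence of the Weingarten function *)

Section WeingartenExistence.
Variables (R : realType) (k n : nat).
Hypothesis n_gt0 : (0 < n)%N.
Local Notation S2k := 'S_(k.*2).
Local Notation H := (hyperoctahedral k).
Local Notation f := (pow_kappa' k (n%:R : R[i])).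

Lemma pow_kappa'_biinvariant : biinvariant f.
Proof.
move=> s h1 h2 h1H h2H.
rewrite [LHS]ffunE [RHS]ffunE /perm_op mulgA.
exact: natr_kappa'_biinvariant.
Qed.

(** The Gram matrix is real symmetric, so F = Y F F for some Y; [y] is the row of Y at the
    identity. *)
Lemma pow_kappa'_factor : exists y : S2k -> R[i], forall t,
  f t = \sum_u \sum_v y u * (f (v * u^-1)%g * f (t * v^-1)%g).
Proof.
pose K (s : S2k) : R := n%:R ^+ kappa' s.
have fK s : f s = (K s)%:C%C by rewrite ffunE rmorphXn /= rmorph_nat.
have KV s : K (s^-1)%g = K s by apply: natr_kappa'_inv.
pose F := \matrix_(a < #|{: S2k}|, b < #|{: S2k}|) K (enum_val b * (enum_val a)^-1)%g.
have FT : F^T = F by apply/matrixP=> a b; rewrite !mxE -KV invMg invgK.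
have /submxP[Y FE] := symmetric_submx_sqr FT.
exists (fun u => (Y (enum_rank 1%g) (enum_rank u))%:C%C) => t.
have := congr1 (fun M : 'M[R]_#|{: S2k}| => M (enum_rank 1%g) (enum_rank t)) FE.
rewrite !mxE !enum_rankK invg1 mulg1 fK => ->; rewrite rmorph_sum /=.
rewrite (reindex (@enum_rank S2k)) /=; last exact/onW_bij/enum_rank_bij.
apply: eq_bigr => u _; rewrite mxE (reindex (@enum_rank S2k)) /=; last first.
  exact/onW_bij/enum_rank_bij.
rewrite rmorphM rmorph_sum mulr_sumr; apply: eq_bigr => v _ /=.
by rewrite !mxE !enum_rankK !fK -!rmorphM.
Qed.

Lemma weingarten_exists : exists W, @is_WgO R k n%:R W.
Proof.
rewrite /is_WgO; move: pow_kappa'_biinvariant pow_kappa'_factor.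
move: (pow_kappa' _ _) => g gB [y gE]; apply: generalized_inverse_exists => //.
pose N : R[i] := #|H|%:R.
have N0 : N != 0 by rewrite card_hyperoctahedral_neq0.
(* [y] solves the linear system but need not be biinvariant. *)
pose W0 : {ffun S2k -> R[i]} :=
  [ffun u => \sum_(h1 in H) \sum_(h2 in H) y (h1 * u * h2)%g].
have W0B : biinvariant W0.
  apply/biinvariantP; split=> h s hH; rewrite !ffunE.
    rewrite (reindex_inj (mulIg h^-1%g)) /=; apply: eq_big => h1.
      by rewrite groupMr // groupV.
    by move=> _; apply: eq_bigr => h2 _; rewrite !mulgA mulgKV.
  apply: eq_bigr => h1 _; rewrite (reindex_inj (mulgI h^-1%g)) /=.
  apply: eq_big => h2; first by rewrite groupMl // groupV.
  by move=> _; rewrite !mulgA mulgK.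
exists W0 => //.
have /biinvariantP[_ gr] := gB.
(* The two sums over H in [W0] produce the N^2 by which two convolutions exceed two [sharp]. *)
suff E : convolution W0 (convolution g g) = [ffun t => N ^+ 2 * g t].
  rewrite (sharp_convolution gB gB) sharp_convolution //; last first.
    exact/biinvariantZ/convolution_biinvariant.
  apply/ffunP=> t; rewrite ffunE convolutionZr ffunE E ffunE -/N expr2.
  by rewrite -mulrA mulKf // mulKf.
apply/ffunP=> t; rewrite [LHS]ffunE [RHS]ffunE.
rewrite (reindex_inj (mulIg t^-1%g)) /=.
under eq_bigr => u _ do rewrite mulgKV invMg invgK [W0 _]ffunE mulr_suml.
rewrite exchange_big /=.
under eq_bigr => h1 _.
  under eq_bigr => u _ do rewrite mulr_suml.
  rewrite exchange_big /=.
  over.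
have conv_g u v : convolution g g (v * u^-1)%g =
    \sum_w  g (w * u^-1)%g *  g (v * w^-1)%g.
  rewrite [LHS]ffunE [RHS](reindex_inj (mulIg v)); apply: eq_bigr => w _ /=.
  by rewrite mulgA invMg mulKVg.
transitivity (\sum_(h1 in H) \sum_(h2 in H)  g (t * h2)%g); last first.
  under eq_bigr => h1 _.
    under eq_bigr => h2 h2H do rewrite gr //.
    rewrite sumr_const; over.
  by rewrite sumr_const -mulrnA -[RHS]/(N ^+ 2 * g t) expr2 -natrM mulr_natl.
apply: eq_bigr => h1 h1H; apply: eq_bigr => h2 h2H.
rewrite gE (reindex_inj (mulgI h1^-1%g)) (reindex_inj (mulIg h2^-1%g)) /=.
apply: eq_bigr => u _; rewrite !mulgA mulgV mul1g mulgKV.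
rewrite -mulr_sumr -conv_g.
have /biinvariantP[_ ggr] := convolution_biinvariant gB gB.
by rewrite !invMg !invgK !mulgA ggr.
Qed.

End WeingartenExistence.

(** * Projection onto invariant tensors *)

Section Projection.
Variables (R : realType) (k n : nat).
Local Notation point := 'I_(k.*2).
Local Notation S2k := 'S_(k.*2).
Local Notation tensor := {ffun point -> 'I_n}.

(** This is [sum_columns] for [U], with U U^T = 1. *)
Lemma delta'_invariant (U : 'M[R]_n) (s : S2k) (f : tensor) :
  orthogonal_mx U ->
  \sum_(g : tensor) (\prod_r U (f r) (g r)) * delta' R s g = delta' R s f.
Proof.
case=> U1 _; transitivity (\sum_(g : tensor | [forall x, g (pairing s x) == g x])
   \prod_r U (f r) (g r)).
  rewrite [RHS]big_mkcond; apply: eq_bigr => g _; rewrite delta'E.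
  by case: ifP => _; rewrite ?mulr1 ?mulr0.
rewrite sum_columns U1 delta'E; set S := half_component _ _.
have bS x : (pairing s x \in S) = (x \notin S).
  apply: mem_half_component_r; try exact: pairingK; try exact: pairing_neq.
  - by rewrite -[std_pairing k]conjg1; apply: pairingK.
  - by move=> y; rewrite -[std_pairing k]conjg1; apply: pairing_neq.
case: forallP => [fE|/forallP].
  by apply: big1 => y _; rewrite mxE (eqP (fE _)) eqxx.
rewrite negb_forall => /existsP[x fx].
rewrite (bigD1 (fold_pt bS x)) //= mxE; case: (x \in S).
  by rewrite eq_sym (negPf fx) mul0r.
by rewrite pairingK (negPf fx) mul0r.
Qed.

(** The real and imaginary parts are treated by [invariant_eq0]; every fixed-point-free involution
    is the pairing of an element of [pair_partitions k]. *)
Lemma invariant_eq0_complex (T : tensor -> R[i]) :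
  (forall U : 'M[R]_n, orthogonal_mx U -> forall f : tensor,
     \sum_(g : tensor) (\prod_r U (f r) (g r))%:C%C * T g = T f) ->
  (forall s : S2k, \sum_(f : tensor) delta' R[i] s f * T f = 0) ->
  forall f, T f = 0.
Proof.
move=> TU T0.
have part (h : R[i] -> R) : (forall x y, h (x + y) = h x + h y) -> h 0 = 0 ->
    (forall (a : R) x, h (a%:C%C * x) = a * h x) -> forall f, h (T f) = 0.
  move=> hD h0 hM; have hsum := big_morph h hD h0.
  apply: (invariant_eq0 (T := fun f => h (T f))) => [U Uo f|t tK t_neq].
    rewrite -(TU U Uo f) hsum; apply: eq_bigr => g _.
    by rewrite hM.
  have [m _ mE] := pair_partition_exists tK t_neq.
  transitivity (h (\sum_(f : tensor) delta' R[i] m f * T f)); last by rewrite T0.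
  rewrite hsum big_mkcond; apply: eq_bigr => f _; rewrite delta'E.
  rewrite (eq_forallb (fun x => congr1 (fun y => f y == f x) (mE x))).
  by case: ifP => _; rewrite ?mul1r // mul0r h0.
move=> f; apply/eqP; rewrite eq_complex /= part ?part ?eqxx //.
- by case=> a b [c d].
- by move=> a [c d] /=; rewrite mul0r addr0.
- by case=> a b [c d].
- by move=> a [c d] /=; rewrite mul0r subr0.
Qed.

Hypothesis n_gt0 : (0 < n)%N.
Variable W : {ffun S2k -> R[i]}.
Hypothesis WP : is_WgO n%:R W.
Local Notation H := (hyperoctahedral k).
Let G : {ffun S2k -> R[i]} := pow_kappa' k n%:R.
Let GB : biinvariant G. Proof. exact: pow_kappa'_biinvariant. Qed.
Let WB : biinvariant W. Proof. by case: WP. Qed.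
Let N : R[i] := #|H|%:R.
Let N0 : N != 0. Proof. exact: card_hyperoctahedral_neq0. Qed.

Let gram s t : \sum_(f : tensor) delta' R[i] s f * delta' R[i] t f = G (t * s^-1)%g.
Proof. by rewrite gram_delta' // ffunE. Qed.

Lemma gram_weingarten_gram r t :
  \sum_v \sum_w G (v * r^-1)%g * W (w * v^-1)%g * G (t * w^-1)%g =
  N ^+ 2 * G (t * r^-1)%g.
Proof.
have : sharp (sharp G W) G = G by case: WP.
rewrite (sharp_convolution (sharp_biinvariant GB WB) GB) (sharp_convolution GB WB).
rewrite convolutionZl => /ffunP/(_ (t * r^-1)%g).
rewrite ffunE [X in _ * X]ffunE -/N => <-.
by rewrite expr2 -mulrA mulVKf // mulVKf // convolution3E.
Qed.

Lemma weingarten_delta' r (g : tensor) :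
  N ^+ 2 * delta' R[i] r g =
  \sum_s (\sum_v G (v * r^-1)%g * W (s * v^-1)%g) * delta' R[i] s g.
Proof.
(* [eps] lies in the kernel of the Gram matrix, so the combination [e] of the
   [delta'] with coefficients [eps] has norm zero. *)
pose c s := \sum_v G (v * r^-1)%g * W (s * v^-1)%g.
pose eps s := N ^+ 2 * (s == r)%:R - c s.
pose e (h : tensor) := \sum_s eps s * delta' R[i] s h.
have eE h : e h = N ^+ 2 * delta' R[i] r h - \sum_s c s * delta' R[i] s h.
  rewrite /e; under eq_bigr => s _ do rewrite mulrBl.
  rewrite sumrB; congr (_ - _); rewrite (bigD1 r) //= eqxx mulr1 big1 ?addr0 //.
  by move=> s /negPf ->; rewrite mulr0 mul0r.
have e_orth (t : S2k) : \sum_(h : tensor) delta' R[i] t h * e h = 0.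
  under eq_bigr => h _ do rewrite eE mulrBr mulrCA mulr_sumr.
  rewrite sumrB -mulr_sumr exchange_big /=.
  under [in X in X - _]eq_bigr => h _ do rewrite mulrC.
  rewrite gram; apply/eqP; rewrite subr_eq0 -gram_weingarten_gram exchange_big /=.
  apply/eqP/eq_bigr => s _; under [RHS]eq_bigr => h _ do rewrite mulrCA [delta' _ _ _ * _]mulrC.
  by rewrite -mulr_sumr gram mulr_suml.
have e_norm : \sum_(h : tensor) `|e h| ^+ 2 = 0.
  have conj_d s (h : tensor) : (delta' R[i] s h)^* = delta' R[i] s h.
    by rewrite delta'E conjC_nat.
  under eq_bigr => h _ do rewrite normCK mulrC rmorph_sum mulr_suml.
  rewrite exchange_big big1 // => s _ /=.
  under eq_bigr => h _ do rewrite rmorphM /= conj_d -mulrA.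
  by rewrite -mulr_sumr e_orth mulr0.
have /eqP := e_norm; rewrite psumr_eq0; last by move=> h _; rewrite exprn_ge0.
move=> /allP/(_ g (mem_index_enum g)); rewrite /= sqrf_eq0 normr_eq0 eE subr_eq0.
by move/eqP.
Qed.

(** N^2 T minus the proposed combination is invariant and, by [weingarten_delta'], orthogonal to
    every [delta']; so it vanishes. Restricting both sums from the group to M_2k then cancels
    N^2. *)
Lemma invariant_projection (T : tensor -> R) (f : tensor) :
  tensor_invariant T ->
  (T f)%:C%C = \sum_(s in pair_partitions k) \sum_(t in pair_partitions k)
    delta' R[i] s f * W (t * s^-1)%g * (\sum_(g : tensor) delta' R t g * T g)%:C%C.
Proof.
move=> Tinv; pose m t : R[i] := (\sum_(g : tensor) delta' R t g * T g)%:C%C.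
have mE t : m t = \sum_(g : tensor) delta' R[i] t g * (T g)%:C%C.
  rewrite /m rmorph_sum; apply: eq_bigr => g _ /=.
  by rewrite rmorphM /= !delta'E rmorph_nat.
have dC s (g : tensor) : delta' R[i] s g = (delta' R s g)%:C%C.
  by rewrite !delta'E rmorph_nat.
pose b s := \sum_t W (t * s^-1)%g * m t.
pose D (g : tensor) := N ^+ 2 * (T g)%:C%C - \sum_s delta' R[i] s g * b s.
have D0 g : D g = 0.
  apply: invariant_eq0_complex => [U Uo h|r].
    under eq_bigr => q _ do rewrite mulrBr mulrCA mulr_sumr.
    rewrite sumrB -mulr_sumr; congr (_ * _ - _).
      rewrite -(Tinv U Uo h) rmorph_sum; apply: eq_bigr => q _ /=.
      by rewrite rmorphM.
    rewrite exchange_big; apply: eq_bigr => s _ /=.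
    under eq_bigr => q _ do rewrite mulrA.
    rewrite -mulr_suml; congr (_ * _).
    rewrite dC -(delta'_invariant s h Uo) rmorph_sum; apply: eq_bigr => q _ /=.
    by rewrite rmorphM dC.
  under eq_bigr => q _ do rewrite mulrBr mulrCA mulr_sumr.
  rewrite sumrB -mulr_sumr -mE exchange_big; apply/eqP; rewrite subr_eq0; apply/eqP.
  transitivity (\sum_v G (v * r^-1)%g * b v); last first.
    apply: eq_bigr => v _ /=; under [RHS]eq_bigr => q _ do rewrite mulrA.
    by rewrite -mulr_suml gram.
  rewrite mE mulr_sumr; under eq_bigr => q _ do rewrite mulrA weingarten_delta' mulr_suml.
  rewrite exchange_big /=; under eq_bigr => s _.
    under eq_bigr => q _ do rewrite -mulrA.
    rewrite -mulr_sumr -mE mulr_suml; over.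
  rewrite exchange_big; apply: eq_bigr => v _ /=; rewrite mulr_sumr.
  by apply: eq_bigr => s _; rewrite mulrA.
have [Wl Wr] := (biinvariantP _).1 WB.
apply: (mulfI (_ : N ^+ 2 != 0)); first by rewrite expf_neq0.
have /eqP := D0 f; rewrite subr_eq0 => /eqP ->.
transitivity (\sum_s \sum_t delta' R[i] s f * W (t * s^-1)%g * m t).
  by apply: eq_bigr => s _; rewrite mulr_sumr; apply: eq_bigr => t _; apply: mulrA.
rewrite (sum_pair_partitions (F := fun s => \sum_t delta' R[i] s f * W (t * s^-1)%g * m t)).
  rewrite expr2 -mulrA mulr_natl; congr (_ *+ _).
  rewrite mulr_natl -sumrMnl; apply: eq_bigr => s _.
  apply: (sum_pair_partitions (F := fun t => delta' R[i] s f * W (t * s^-1)%g * m t)).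
  move=> h t hH /=; rewrite -mulgA (Wl h) //; congr (_ * _).
  by rewrite !mE; apply: eq_bigr => g _; rewrite delta'_hM.
move=> h s hH /=; apply: eq_bigr => t _.
by rewrite delta'_hM // invMg mulgA Wr // groupV.
Qed.

End Projection.

(** * Projection in the row and the column indices *)

Section MomentExpansion.
Variables (R : realType) (k n p : nat).
Hypotheses (n_gt0 : (0 < n)%N) (p_gt0 : (0 < p)%N).
Local Notation point := 'I_(k.*2).
Local Notation S2k := 'S_(k.*2).
Local Notation H := (hyperoctahedral k).
Local Notation M := (pair_partitions k).

(** The left side is a product of three kernels once [biinvariant_inv] has inverted the last
    argument. Commutativity moves A to the front, and W1, W2 merge. *)
Lemma weingarten_convolution (W1 W2 A : {ffun S2k -> R[i]}) s1 s2 :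
  biinvariant W1 -> biinvariant W2 -> biinvariant A ->
  \sum_(t1 in M) \sum_(t2 in M)
    W1 (t1 * s1^-1)%g * A (t2 * t1^-1)%g * W2 (t2 * s2^-1)%g =
  \sum_(q in M) sharp W1 W2 (s2 * s1^-1 * q^-1)%g * A q.
Proof.
move=> W1B W2B AB; pose N : R[i] := #|H|%:R.
have N0 : N != 0 by apply: card_hyperoctahedral_neq0.
have W12B := sharp_biinvariant W1B W2B.
have [W1l W1r] := (biinvariantP _).1 W1B.
have [W2l W2r] := (biinvariantP _).1 W2B.
have [Al Ar] := (biinvariantP _).1 AB.
have [W12l W12r] := (biinvariantP _).1 W12B.
apply: (mulfI (_ : N ^+ 2 != 0)); first by rewrite expf_neq0.
transitivity (convolution (convolution W1 A) W2 (s2 * s1^-1)%g).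
  rewrite convolution3E.
  pose F t1 t2 := W1 (t1 * s1^-1)%g * A (t2 * t1^-1)%g * W2 (s2 * t2^-1)%g.
  rewrite [RHS](sum_pair_partitions (F := fun t1 => \sum_t2 F t1 t2)); last first.
    move=> h t hH; apply: eq_bigr => u _; rewrite /F -[(h * t * _)%g]mulgA (W1l h) //.
    by rewrite invMg mulgA Ar // groupV.
  rewrite expr2 -mulrA mulr_natl; congr (_ *+ _).
  rewrite mulr_natl -sumrMnl; apply: eq_bigr => t1 _.
  rewrite (sum_pair_partitions (F := F t1)).
    congr (_ *+ _); apply: eq_bigr => t2 _; rewrite /F; congr (_ * _).
    by rewrite -(biinvariant_inv _ W2B) invMg invgK.
  move=> h t hH; rewrite /F -[(h * t * _)%g]mulgA (Al h) //.
  by rewrite invMg mulgA W2r // groupV.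
rewrite (convolutionC W1B AB) convolutionA.
(* One factor N is absorbed in [sharp W1 W2], the other in the sum over [q]. *)
transitivity (N * convolution A (sharp W1 W2) (s2 * s1^-1)%g).
  by rewrite (sharp_convolution W1B W2B) convolutionZr [X in _ * X]ffunE mulVKf.
rewrite expr2 -mulrA; congr (_ * _).
rewrite ffunE (reindex_inj (mulIg (s2 * s1^-1)^-1%g)) /=.
under eq_bigr => q _ do rewrite mulgKV invMg invgK mulrC.
rewrite mulr_natl.
apply: (sum_pair_partitions (F := fun q => sharp W1 W2 (s2 * s1^-1 * q^-1)%g * A q)).
by move=> h t hH /=; rewrite (Al h) // invMg mulgA W12r // groupV.
Qed.

Variables (m : {ffun point -> 'I_n} -> {ffun point -> 'I_p} -> R) (a : S2k -> R).
Hypothesis m_invl : forall g, tensor_invariant (fun f => m f g).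
Hypothesis m_invr : forall f, tensor_invariant (m f).
Hypothesis m_contract : forall s t, 
  \sum_(f : {ffun point -> 'I_n}) \sum_(g : {ffun point -> 'I_p})
     delta' R s f * delta' R t g * m f g = a (t * s^-1)%g.
Hypothesis a_biinv : forall h1 h2 s, h1 \in H -> h2 \in H -> a (h1 * s * h2)%g = a s.

(** Projecting in [f] leaves the tensors [m1 t] in [g]; projecting these leaves double contractions,
    which are values of [a]. *)
Lemma moment_expansion (W1 W2 : {ffun S2k -> R[i]}) f g :
  is_WgO n%:R W1 -> is_WgO p%:R W2 ->
  (m f g)%:C%C =
  \sum_(s1 in M) \sum_(s2 in M) \sum_(q in M)
    delta' R[i] s1 f * delta' R[i] s2 g * sharp W1 W2 (s2 * s1^-1 * q^-1)%g * (a q)%:C%C.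
Proof.
move=> W1P W2P; have W1B : biinvariant W1 by case: W1P.
have W2B : biinvariant W2 by case: W2P.
pose A : {ffun S2k -> R[i]} := [ffun s => (a s)%:C%C].
have AB : biinvariant A.
  by move=> s h1 h2 h1H h2H; rewrite !ffunE /perm_op mulgA a_biinv.
pose m1 t g := \sum_(f : {ffun point -> 'I_n}) delta' R t f * m f g.
have m1_inv t : tensor_invariant (m1 t).
  move=> U Uo g0; under eq_bigr => g1 _ do rewrite mulr_sumr.
  rewrite exchange_big; apply: eq_bigr => f1 _ /=.
  rewrite -(m_invr f1 Uo g0) mulr_sumr; apply: eq_bigr => g1 _; exact: mulrCA.
rewrite (invariant_projection n_gt0 W1P f (m_invl g)); apply: eq_bigr => s1 _.
under eq_bigr => t1 _.
  rewrite (invariant_projection p_gt0 W2P g (m1_inv t1)) mulr_sumr.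
  over.
rewrite exchange_big; apply: eq_bigr => s2 _ /=.
under [RHS]eq_bigr => q _ do rewrite -mulrA -[(a q)%:C%C](ffunE (fun s => (a s)%:C%C)).
rewrite -mulr_sumr -weingarten_convolution // mulr_sumr; apply: eq_bigr => t1 _.
rewrite !mulr_sumr; apply: eq_bigr => t2 _.
rewrite (_ : \sum_g0 _ = a (t2 * t1^-1)%g); last first.
  rewrite -m_contract exchange_big; apply: eq_bigr => g1 _ /=.
  by rewrite mulr_sumr; apply: eq_bigr => f1 _; rewrite mulrCA mulrA.
rewrite !ffunE; ring.
Qed.

End MomentExpansion.

Local Open Scope classical_set_scope.
Local Open Scope ring_scope.

(** * Moments of a random matrix *)

Section Expectation.
Context d (T : measurableType d) (R : realType) (P : probability T R).

Lemma eq_expectation_law (Y Z : T -> R) :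
  measurable_fun [set: T] Y -> measurable_fun [set: T] Z ->
  P.-integrable [set: T] (EFin \o Y) -> P.-integrable [set: T] (EFin \o Z) ->
  (forall B, measurable B -> P (Y @^-1` B) = P (Z @^-1` B)) ->
  ('E_P[Y] = 'E_P[Z])%E.
Proof.
move=> mY mZ iY iZ YZ; rewrite unlock.
rewrite -(integral_pushforward mY (f := EFin) _ iY measurableT) //.
rewrite -(integral_pushforward mZ (f := EFin) _ iZ measurableT) //.
by apply: eq_measure_integral => B mB _; apply: YZ.
Qed.

Lemma integrable_lincomb (I : Type) (s : seq I) (c : I -> R) (Y : I -> T -> R) :
  (forall i, P.-integrable [set: T] (EFin \o Y i)) ->
  P.-integrable [set: T] (EFin \o (fun t => \sum_(i <- s) c i * Y i t)).
Proof.
move=> iY; rewrite (_ : _ \o _ = fun t => (\sum_(i <- s) ((c i)%:E * (Y i t)%:E))%E).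
  by apply: integrable_sum => // i _; apply: integrableZl => //; apply: iY.
by apply/funext => t /=; rewrite -sumEFin.
Qed.

Lemma expectation_lincomb (I : Type) (s : seq I) (c : I -> R) (Y : I -> T -> R) :
  (forall i, P.-integrable [set: T] (EFin \o Y i)) ->
  fine 'E_P[fun t => \sum_(i <- s) c i * Y i t] = \sum_(i <- s) c i * fine 'E_P[Y i].
Proof.
move=> iY; rewrite unlock.
under eq_integral => t _ do rewrite -sumEFin.
rewrite integral_sum //; last first.
  by move=> i; under eq_fun do rewrite EFinM; apply: integrableZl => //; apply: iY.
rewrite (eq_bigr (fun i => (c i * fine (\int[P]_t (Y i t)%:E)%E)%:E)).
  by rewrite sumEFin.
move=> i _; under eq_integral do rewrite EFinM.
rewrite integralZl //; last exact: iY.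
by rewrite EFinM fineK // integrable_fin_num //; exact: iY.
Qed.

End Expectation.

Section Moments.
Context d (T : measurableType d) (R : realType) (P : probability T R) (n p k : nat).
Variable X : T -> 'M[R]_(n, p).
Hypothesis X_random : random_matrix X.
Hypothesis X_moments : forall (a : 'I_n) (b : 'I_p),
  P.-integrable [set: T] (fun t => (X t a b ^+ (k.*2))%:E).
Hypothesis k_gt0 : (0 < k)%N.
Local Notation borel_mx := (g_sigma_algebraType (@open 'M[R]_(n, p))).

Lemma measurable_coord_mx a b :
  measurable_fun [set: borel_mx] (fun A : borel_mx => (A : 'M[R]_(n, p)) a b).
Proof.
apply: (measurability _ (RGenOpens.measurableE R)) => //.
move=> _ [_ [x [y ->] <-]]; rewrite setTI; apply: sub_sigma_algebra.
by apply: open_comp (interval_open _ _) => // A _; apply: coord_continuous.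
Qed.

Lemma measurable_coord a b : measurable_fun [set: T] (fun t => X t a b).
Proof. exact: (measurableT_comp (measurable_coord_mx a b) X_random). Qed.

Lemma measurable_monomial (f : 'I_(k.*2) -> 'I_n) (g : 'I_(k.*2) -> 'I_p) :
  measurable_fun [set: T] (fun t => \prod_r X t (f r) (g r)).
Proof. by apply: measurable_prod => r _; apply: measurable_coord. Qed.

(** The sum B of the 2k-th powers of the factors dominates: each factor satisfies |x|^2k <= B, so
    the 2k-th power of the monomial is at most B^2k. *)
Lemma integrable_monomial (f : 'I_(k.*2) -> 'I_n) (g : 'I_(k.*2) -> 'I_p) :
  P.-integrable [set: T] (EFin \o fun t => \prod_r X t (f r) (g r)).
Proof.
pose B t := \sum_(r < k.*2) 1 * X t (f r) (g r) ^+ k.*2.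
apply: (@le_integrable _ _ _ _ _ _ _ (EFin \o B)) => //.
- exact/measurable_EFinP/measurable_monomial.
- move=> t _ /=; rewrite lee_fin.
  have pow_ge0 (x : R) : 0 <= x ^+ k.*2 by rewrite -muln2 exprM sqr_ge0.
  have B_ge0 : 0 <= B t by apply: sumr_ge0 => r _; rewrite mul1r.
  rewrite (ger0_norm B_ge0) -(@ler_pXn2r _ k.*2) ?nnegrE ?double_gt0 //.
  rewrite normr_prod -prodrXl -[leRHS](_ : \prod_(r < k.*2) B t = _); last first.
    by rewrite prodr_const card_ord.
  apply: ler_prod => r _; rewrite exprn_ge0 //=.
  rewrite -normrX ger0_norm // /B (bigD1 r) //= mul1r lerDl.
  by apply: sumr_ge0 => ? _; rewrite mul1r.
- apply: integrable_lincomb => r; exact: X_moments.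
Qed.
End Moments.

Section MomentInvariance.
Context d (T : measurableType d) (R : realType) (P : probability T R) (n p k : nat).
Variable X : T -> 'M[R]_(n, p).
Hypothesis X_random : random_matrix X.
Hypothesis X_moments : forall (a : 'I_n) (b : 'I_p),
  P.-integrable [set: T] (fun t => (X t a b ^+ (k.*2))%:E).
Hypothesis k_gt0 : (0 < k)%N.
Hypothesis X_invariant : forall (U : 'M[R]_n) (V : 'M[R]_p),
  orthogonal_mx U -> orthogonal_mx V ->
  same_distribution P X (fun t => U *m X t *m V).

Definition moment (f : {ffun 'I_(k.*2) -> 'I_n}) (g : {ffun 'I_(k.*2) -> 'I_p}) : R :=
  fine 'E_P[fun t => \prod_r X t (f r) (g r)].

Lemma moment_lincomb (I : finType) (c : I -> R) (F : I -> {ffun 'I_(k.*2) -> 'I_n})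
    (G : I -> {ffun 'I_(k.*2) -> 'I_p}) :
  fine 'E_P[fun t => \sum_i c i * \prod_r X t (F i r) (G i r)] =
  \sum_i c i * moment (F i) (G i).
Proof.
rewrite (expectation_lincomb _ _ (Y := fun i t => \prod_r X t (F i r) (G i r))) //.
by move=> i; apply: integrable_monomial.
Qed.

(** Equality in law of X and U X V passes to the Borel function [phi], and [c], [F], [G] expand the
    monomial of U A V multilinearly. *)
Lemma moment_orthogonal (U : 'M[R]_n) (V : 'M[R]_p) (I : finType) (c : I -> R)
    (F : I -> {ffun 'I_(k.*2) -> 'I_n}) (G : I -> {ffun 'I_(k.*2) -> 'I_p})
    (f : {ffun 'I_(k.*2) -> 'I_n}) (g : {ffun 'I_(k.*2) -> 'I_p}) :
  orthogonal_mx U -> orthogonal_mx V ->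
  (forall A : 'M[R]_(n, p), \prod_r (U *m A *m V) (f r) (g r) =
     \sum_i c i * \prod_r A (F i r) (G i r)) ->
  \sum_i c i * moment (F i) (G i) = moment f g.
Proof.
move=> Uo Vo E; rewrite -moment_lincomb /moment; congr (fine _).
apply: eq_expectation_law.
- apply: measurable_sum => i; apply: measurable_funM; first exact: measurable_cst.
  exact: measurable_monomial.
- exact: measurable_monomial.
- by apply: integrable_lincomb => i; apply: integrable_monomial.
- exact: integrable_monomial.
move=> B mB; pose phi (A : 'M[R]_(n, p)) := \prod_r A (f r) (g r).
have mphi : measurable_fun [set: g_sigma_algebraType (@open 'M[R]_(n, p))] phi.
  by apply: measurable_prod => r _; apply: measurable_coord_mx.
have := mphi measurableT B mB; rewrite setTI => mB'.
have := X_invariant Uo Vo mB'; rewrite /pushforward => XY.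
transitivity (P ((fun t => U *m X t *m V) @^-1` (phi @^-1` B))); last by rewrite -XY.
by congr (P _); apply/funext => t /=; rewrite /phi E.
Qed.

Lemma moment_invariant_l g : tensor_invariant (moment^~ g).
Proof.
move=> U Uo f.
apply: (moment_orthogonal (V := 1%:M) (G := fun=> g) Uo) => [|A].
  by split; rewrite trmx1 mulmx1.
rewrite mulmx1; under eq_bigr => r _ do rewrite mxE.
rewrite (bigA_distr_bigA (fun r a => U (f r) a * A a (g r))).
by apply: eq_bigr => h _; rewrite big_split.
Qed.

Lemma moment_invariant_r f : tensor_invariant (moment f).
Proof.
move=> U [U1 U2] g.
(* Right multiplication acts on columns through the second index of V, hence the transpose. *)
apply: (moment_orthogonal (U := 1%:M) (V := U^T) (F := fun=> f)) => [||A].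
- by split; rewrite trmx1 mulmx1.
- by split; rewrite trmxK.
rewrite mul1mx; under eq_bigr => r _ do rewrite mxE.
rewrite (bigA_distr_bigA (fun r b => A (f r) b * U^T b (g r))).
apply: eq_bigr => h _; rewrite big_split mulrC; congr (_ * _).
by apply: eq_bigr => r _; rewrite mxE.
Qed.

Lemma moment_contraction s t : (0 < n)%N ->
  \sum_(f : {ffun 'I_(k.*2) -> 'I_n}) \sum_(g : {ffun 'I_(k.*2) -> 'I_p})
     delta' R s f * delta' R t g * moment f g =
  fine 'E_P[fun x => Tr' (t * s^-1)%g (X x *m (X x)^T)].
Proof.
move=> n_gt0; rewrite (_ : (fun x => _) = fun x =>
    \sum_(u : {ffun 'I_(k.*2) -> 'I_n} * {ffun 'I_(k.*2) -> 'I_p})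
      delta' R s u.1 * delta' R t u.2 * \prod_r X x (u.1 r) (u.2 r)); last first.
  by apply/funext => x; rewrite -sum_delta'_Tr'_kernel // pair_big.
rewrite (moment_lincomb (fun u : {ffun 'I_(k.*2) -> 'I_n} * {ffun 'I_(k.*2) -> 'I_p} =>
  delta' R s u.1 * delta' R t u.2) fst snd).
by rewrite pair_big.
Qed.

End MomentInvariance.

Lemma WgOP (R : realType) k n : (0 < n)%N ->
  is_WgO (n%:R : R[i]) (WgO k (n%:R : R[i])).
Proof. by move=> n_gt0; apply: xgetPex (weingarten_exists R k n_gt0). Qed.

(* The sum over pi runs over representatives of cosets pi H_k, so the argument
   of WgO2 has to be pi^-1 s1^-1 s2.  With pi s1^-1 s2 the right-hand side
   depends on the choice of representatives, and the identity fails already for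
   n = p = k = 2 and X Haar distributed on O(2): it would give two different
   values for E[x11 x12 x21 x22] and E[x11 x12 x22 x21]. *)
Theorem theorem3p5 (d : measure_display) (T : measurableType d) (R : realType)
    (P : probability T R) (n p k : nat)
    (n_ge1 : (1 <= n)%N) (p_ge1 : (1 <= p)%N) (k_ge1 : (1 <= k)%N)
    (X : T -> 'M[R]_(n, p)) (X_random : random_matrix X)
    (X_invariant : forall (U : 'M[R]_n) (V : 'M[R]_p),
        orthogonal_mx U -> orthogonal_mx V ->
        same_distribution P X (fun t => U *m X t *m V))
    (X_moments : forall (a : 'I_n) (b : 'I_p),
        P.-integrable [set: T] (fun t => (X t a b ^+ (k.*2))%:E))
    (i : 'I_(k.*2) -> 'I_n) (j : 'I_(k.*2) -> 'I_p) :
  expectC P (fun t => \prod_(r < k.*2) X t (i r) (j r)) =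
  \sum_(s1 in pair_partitions k) \sum_(s2 in pair_partitions k)
    \sum_(q in pair_partitions k)
      delta' R[i] s1 i * delta' R[i] s2 j *
      WgO2 k n%:R p%:R ((q^-1)%g \op (s1^-1)%g \op s2) *
      expectC P (fun t => Tr' q (X t *m (X t)^T)).
Proof.
pose a (q : 'S_(k.*2)) := fine 'E_P[fun x => Tr' q (X x *m (X x)^T)].
have a_biinv h1 h2 (s : 'S_(k.*2)) : h1 \in hyperoctahedral k ->
    h2 \in hyperoctahedral k -> a (h1 * s * h2)%g = a s.
  move=> h1H h2H.
  have E x : Tr' (h1 * s * h2)%g (X x *m (X x)^T) = Tr' s (X x *m (X x)^T).
    by rewrite Tr'_biinvariant.
  exact: (congr1 (fun Y => fine 'E_P[Y]) (funext E)).
have delta'_finfun m s (f : 'I_(k.*2) -> 'I_m) :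
    delta' R[i] s f = delta' R[i] s (finfun f).
  by apply: eq_bigr => r _; rewrite !ffunE.
transitivity ((moment P X (finfun i) (finfun j))%:C%C).
  have E t : \prod_r X t (i r) (j r) = \prod_r X t (finfun i r) (finfun j r).
    by apply: eq_bigr => r _; rewrite !ffunE.
  exact: (congr1 (fun Y => expectC P Y) (funext E)).
rewrite (moment_expansion n_ge1 p_ge1 (m := moment P (k := k) X) (a := a)
  (moment_invariant_l X_random X_moments k_ge1 X_invariant)
  (moment_invariant_r X_random X_moments k_ge1 X_invariant)
  (fun s t => moment_contraction X_random X_moments k_ge1 s t n_ge1)
  a_biinv _ _ (WgOP R k n_ge1) (WgOP R k p_ge1)).
apply: eq_bigr => s1 _; apply: eq_bigr => s2 _; apply: eq_bigr => q _.
(* Unfolding [perm_op] reverses the factors, which gives the argument [s2 * s1^-1 * q^-1]. *)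
by rewrite -!delta'_finfun /WgO2 /perm_op mulgA.
Qed.
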